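(* There are exactly $27$ complex projective lines contained in a generic cubic surface in $\mathbb{C}\mathrm{P}^3$.
   Context: ''Generic'' means: for all defining polynomials in a nonempty Zariski open subset of the space of complex homogeneous polynomials of degree $3$ in $4$ variables. *)

(* Defs.v *)
From HB Require Import structures.
From mathcomp Require Import all_boot all_order all_algebra.
From mathcomp Require Import classical_sets functions cardinality reals.
From mathcomp Require Import complex mpoly.

Set Implicit Arguments.
Unset Strict Implicit.
Unset Printing Implicit Defensive.

Import GRing.Theory.

Local Open Scope classical_set_scope.
Local Open Scope ring_scope.

(* Note the shift: n is the dimension of the projective space.               *)
Notation hpoly K n d := (dhomog n.+1 K d).

Section Zariski.
Variables (K : fieldType) (V : vectType K).

(* Polynomial functions on V are polynomials in the coordinates with respect *)
(* to a basis of V; the resulting topology does not depend on the basis.     *)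
Definition zariski_closed (A : set V) : Prop :=
  exists S : set {mpoly K[\dim {:V}]},
    A = [set v | forall p, S p -> p.@[fun i => coord (vbasis {:V}) i v] = 0].

Definition zariski_open (A : set V) : Prop := zariski_closed (~` A).

Definition generic (P : V -> Prop) : Prop :=
  exists U : set V,
    [/\ zariski_open U, U !=set0 & forall v, U v -> P v].

End Zariski.

Section Projective.
Variables (K : fieldType) (n : nat).

(* A point of P^n(K) is a one-dimensional linear subspace of K^(n+1).        *)
Definition proj_space : Type := {x : {vspace 'rV[K]_n.+1} | \dim x == 1%N}.

Definition proj_line (l : set proj_space) : Prop :=
  exists2 L : {vspace 'rV[K]_n.+1},
    \dim L = 2%N & l = [set x : proj_space | (sval x <= L)%VS].

(* The condition is imposed on all representatives, including 0, where it    *)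
(* is automatic for d > 0.                                                   *)
Definition hypersurface d (f : hpoly K n d) : set proj_space :=
  [set x : proj_space | forall v : 'rV[K]_n.+1,
             v \in sval x -> (f : {mpoly K[n.+1]}).@[v 0] = 0].

Definition lines_in (X : set proj_space) : set (set proj_space) :=
  [set l | proj_line l /\ l `<=` X].

End Projective.

(* Main.v *)
From HB Require Import structures.
Require Import Defs.
From mathcomp Require Import all_boot all_order all_algebra.
From mathcomp Require Import classical_sets functions cardinality reals.
From mathcomp Require Import complex mpoly.
From mathcomp Require Import fingroup perm closed_field ring.
From mathcomp Require Import boolp.

(** The proof writes a generic cubic as a sum of two products of three linear forms
    and reads the 27 lines off that shape.

    Let y_1, y_2, y_3 and y'_1, y'_2, y'_3 be linear forms on a 4-dimensional space,
    and consider the cubic y_1 y_2 y_3 + y'_1 y'_2 y'_3.  Six forms in four variables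
    satisfy a pencil of linear relations; normalise two of them to sum y_k = 0 and
    sum a_k y_k = 0, over all six indices.  If the a_k are distinct, any four of the
    forms are coordinates.  Nine lines y_i = y'_j = 0 lie on the surface.  On any
    other line of the surface the equation y_1 y_2 y_3 = - y'_1 y'_2 y'_3 is an
    equality of two factored binary cubics, so the factors are proportional in pairs
    (y_i with y'_(s i), for a permutation s), and the proportionality constants come
    from one relation of the pencil, of coefficients c_k = t_0 + t_1 a_k: the line is
    given by c_i y_i + c'_(s i) y'_(s i) = 0.  It lies on the surface exactly when
    the product of the c_i equals the product of the c'_j, which is a binary cubic
    equation in (t_0, t_1).  If it has three distinct roots there are 3 * 3! such
    lines, and 9 + 18 = 27 ([lines_of_trihedral_cubic]).

    It remains to see that a generic cubic has this shape, with distinct a_k and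
    distinct roots.  Four forms and four of the a_k (the last two being 1 and 0)
    determine the cubic, so there are 16 + 4 = 20 parameters for the
    20-dimensional space of cubics.  At a well-chosen parameter the differential
    of the parametrisation is onto ([curves_in_every_direction], which rests on
    [tangent_quadrics_generate]), hence no nonzero polynomial vanishes on its image
    ([vanish_on_curves]).  By elimination of quantifiers over an algebraically
    closed field, the image of the good parameters or its complement contains a
    nonempty open set ([image_generic]); density leaves only the first case
    ([generic_of_dominant]). *)

Set Implicit Arguments.
Unset Strict Implicit.
Unset Printing Implicit Defensive.

Import GRing.Theory Num.Theory.

Local Open Scope classical_set_scope.
Local Open Scope ring_scope.

(** * Polynomials and their zeros *)

Lemma poly_nonvanishing (R : numDomainType) (p : {poly R}) :
  p != 0 -> exists t, p.[t] != 0.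
Proof.
move=> p0; pose s := [seq (i%:R : R) | i <- iota 0 (size p)].
have /allPn[t _ nrt] : ~~ all (root p) s.
  apply/negP => rs; have := max_poly_roots p0 rs.
  rewrite map_inj_uniq ?iota_uniq; last by move=> i j /eqP; rewrite eqr_nat => /eqP.
  by rewrite size_map size_iota ltnn => /(_ isT).
by exists t.
Qed.

Lemma digits_inj n d (u v : 'I_n -> nat) :
  (forall i, u i < d)%N -> (forall i, v i < d)%N ->
  (\sum_(i < n) u i * d ^ i = \sum_(i < n) v i * d ^ i)%N -> u =1 v.
Proof.
elim: n u v => [|n IHn] u v ud vd; first by move=> _ [].
have split (w : 'I_n.+1 -> nat) : (\sum_(i < n.+1) w i * d ^ i =
    w ord0 + (\sum_(i < n) w (lift ord0 i) * d ^ i) * d)%N.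
  rewrite big_ord_recl expn0 muln1 big_distrl; congr addn.
  by apply: eq_bigr => i _; rewrite /= /bump leq0n add1n expnSr mulnA.
rewrite !split => E.
have d0 : (0 < d)%N by apply: leq_ltn_trans (ud ord0).
have E0 : u ord0 = v ord0.
  by have := congr1 (modn^~ d) E; rewrite !(addnC _ (_ * d)%N) !modnMDl !modn_small.
have /(IHn (fun i => u (lift ord0 i)) (fun i => v (lift ord0 i))) IH :
   (\sum_(i < n) u (lift ord0 i) * d ^ i = \sum_(i < n) v (lift ord0 i) * d ^ i)%N.
  by move: E; rewrite E0 => /addnI /eqP; rewrite eqn_pmul2r // => /eqP.
move=> i; case: (unliftP ord0 i) => [j|] -> //; exact: IH.
Qed.

(** Kronecker substitution: replacing the i-th variable by t ^ (d ^ i), with d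
    above the degree, maps distinct monomials to distinct powers of t. *)
Lemma mpoly_nonvanishing (R : numDomainType) n (p : {mpoly R[n]}) :
  p != 0 -> exists v, p.@[v] != 0.
Proof.
move=> p0; pose d := msize p.
pose e (m : 'X_{1..n}) := (\sum_(i < n) m i * d ^ i)%N.
pose P := \sum_(m <- msupp p) p@_m *: 'X^(e m) : {poly R}.
have Pev t : P.[t] = p.@[fun i => t ^+ (d ^ i)].
  rewrite mevalE horner_sum; apply: eq_bigr => m _.
  rewrite hornerZ hornerXn; congr (_ * _).
  rewrite /e expr_sum; apply: eq_bigr => i _.
  by rewrite mulnC exprM.
have P0 : P != 0.
  have m0 := mlead_supp p0; set m1 := mlead p in m0.
  apply/eqP => /(congr1 (fun q : {poly R} => q`_(e m1))).
  rewrite coef0 coef_sum (bigD1_seq m1) ?msupp_uniq //= big_seq_cond big1.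
    by rewrite addr0 coefZ coefXn eqxx mulr1 => /eqP; rewrite mleadc_eq0 (negPf p0).
  move=> m /andP[mp mm1]; rewrite coefZ coefXn; case: eqP => [E|]; last by rewrite mulr0.
  case/eqP: mm1; apply/mnmP; apply: (@digits_inj _ d) => // i.
    apply: leq_ltn_trans (msize_mdeg_lt mp).
    by rewrite mdegE (bigD1 i) //= leq_addr.
  apply: leq_ltn_trans (msize_mdeg_lt m0).
  by rewrite mdegE (bigD1 i) //= leq_addr.
have [t Pt] := poly_nonvanishing P0.
by exists (fun i => t ^+ (d ^ i)); rewrite -Pev.
Qed.

Definition mpoly_curve (R : comNzRingType) n (c : 'I_n -> {poly R}) :
  {mpoly R[n]} -> {poly R} := mmap polyC c.

Lemma horner_mpoly_curve (R : comNzRingType) n (c : 'I_n -> {poly R}) p t :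
  (mpoly_curve c p).[t] = p.@[fun i => (c i).[t]].
Proof.
rewrite mevalE horner_sum; apply: eq_bigr => m _.
rewrite hornerM hornerC horner_prod; congr (_ * _).
by apply: eq_bigr => i _; rewrite horner_exp.
Qed.

Lemma meval_dhomog (R : comNzRingType) n d (p : {mpoly R[n]}) v t :
  p \is d.-homog -> p.@[fun i => t * v i] = t ^+ d * p.@[v].
Proof.
move/dhomogP => hp; rewrite !mevalE mulr_sumr.
rewrite !(big_seq_cond xpredT); apply: eq_bigr => m; rewrite andbT => /hp <-.
rewrite [RHS]mulrCA; congr (_ * _); rewrite /= mdegE expr_sum -big_split /=.
by apply: eq_bigr => i _; rewrite exprMn.
Qed.

(** If [c] passes through [p0] with velocity [w], the restriction of [h] to [c] has,
    in the degree of the lowest homogeneous part of [h] at [p0], the value at [w] of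
    that part as its coefficient.  So the lowest part vanishes at every [w]. *)
Lemma vanish_on_curves (R : numDomainType) n (h : {mpoly R[n]}) (p0 : 'I_n -> R) :
  (forall w : 'I_n -> R, exists c : 'I_n -> {poly R},
    [/\ forall i, (c i)`_0 = p0 i, forall i, (c i)`_1 = w i &
        forall t, h.@[fun i => (c i).[t]] = 0]) -> h = 0.
Proof.
move=> H; apply/eqP/negPn/negP => h0.
(* translate p0 to the origin *)
pose h1 := h \mPo [tuple 'X_i + (p0 i)%:MP | i < n].
have h10 : h1 != 0.
  have [v hv] := mpoly_nonvanishing h0.
  apply: contraNneq hv => h10.
  suff <- : h1.@[fun i => v i - p0 i] = h.@[v] by rewrite h10 meval0.
  rewrite comp_mpoly_meval; apply: meval_eq => i.
  by rewrite tnth_mktuple mevalD mevalXU mevalC subrK.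
pose part d := pihomog mdeg d h1.
have h1E : h1 = \sum_(d < msize h1) part d.
  apply: pihomog_partitionE; exact: leqnn.
have exk : exists k, part k != 0.
  move: h10; rewrite {1}h1E => /eqP nz; case: (pselect (exists k, part k != 0)) => //.
  move=> nex; case: nz; apply: big1 => d _; apply/eqP/negPn/negP => pd.
  by apply: nex; exists d.
have [k pk kmin] := ex_minnP exk.
have [w] := mpoly_nonvanishing pk; case/eqP.
have [c [c0 c1 hc]] := H w.
(* c = p0 + t r, where r has constant term w *)
pose r i := drop_poly 1 (c i).
have cE i t : (c i).[t] = t * (r i).[t] + p0 i.
  rewrite -[in LHS](poly_take_drop 1 (c i)) hornerD hornerM hornerXn expr1 mulrC.
  by rewrite addrC -c0 -horner_coef0 /take_poly horner_poly big_ord1 mulr1 -horner_coef0.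
(* the restriction of h to c, expanded along the homogeneous parts *)
pose G := \sum_(d < msize h1) 'X^d * mpoly_curve r (part d).
have G0 : G = 0.
  apply/eqP/negPn/negP => /poly_nonvanishing[t]; case/eqP.
  rewrite -(hc t) horner_sum.
  transitivity (h1.@[fun i => t * (r i).[t]]).
    rewrite [in RHS]h1E raddf_sum /=; apply: eq_bigr => d _.
    rewrite hornerM hornerXn horner_mpoly_curve.
    by rewrite -meval_dhomog // pihomogP.
  rewrite comp_mpoly_meval; apply: meval_eq => i.
  by rewrite tnth_mktuple mevalD mevalXU mevalC cE.
have lt_k : (k < msize h1)%N.
  rewrite ltnNge; apply: contra pk => le_k; rewrite /part /pihomog big_seq_cond.
  rewrite big1 // => m /andP[mh /eqP mk].
  by have := msize_mdeg_lt mh; rewrite mk ltnNge le_k.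
have := congr1 (fun q : {poly R} => q`_k) G0.
rewrite coef0 coef_sum (bigD1 (Ordinal lt_k)) //= big1 => [|d dk].
  rewrite addr0 coefXnM ltnn subnn -horner_coef0 horner_mpoly_curve => <-.
  by apply: meval_eq => i; rewrite horner_coef0 coef_drop_poly c1.
rewrite coefXnM; case: ltnP => // le_dk.
have -> : part d = 0.
  apply/eqP/negPn/negP => /kmin; rewrite leqNgt ltn_neqAle le_dk andbT.
  by move: dk; rewrite -val_eqE => ->.
by rewrite /mpoly_curve mmap0 coef0.
Qed.

(** * Generic truth of first-order statements *)

Definition env (K : fieldType) n (y : 'I_n -> K) : seq K := codom y.

Lemma nth_env (K : fieldType) n (y : 'I_n -> K) (i : 'I_n) : (env y)`_i = y i.
Proof. by rewrite /env codomE (nth_map i) ?size_enum_ord // nth_ord_enum. Qed.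

(** The index map [idx] leaves room for a second block of variables. *)
Lemma term_of_mpoly (K : fieldType) n (idx : 'I_n -> nat) (p : {mpoly K[n]}) :
  exists2 t : GRing.term K, GRing.rterm t &
    forall e, GRing.eval e t = p.@[fun i => e`_(idx i)].
Proof.
pose mon (m : 'X_{1..n}) := foldr (fun i u =>
  GRing.Mul (GRing.Exp (GRing.Var K (idx i)) (m i)) u) (GRing.NatConst K 1) (index_enum 'I_n).
pose pol s := foldr (fun m u =>
  GRing.Add (GRing.Mul (GRing.Const p@_m) (mon m)) u) (GRing.NatConst K 0) s.
have rmon m : GRing.rterm (mon m) by rewrite /mon; elim: index_enum.
exists (pol (msupp p)); first by elim: (msupp p) => //= m s ->; rewrite rmon.
move=> e; rewrite mevalE; elim: (msupp p) => [|m s IHs]; first by rewrite big_nil.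
rewrite big_cons -IHs /=; congr (_ * _ + _).
rewrite /mon; elim: index_enum => [|i r IHr] /=; first by rewrite big_nil.
by rewrite big_cons IHr.
Qed.

Lemma mpoly_of_term (K : fieldType) n (t : GRing.term K) : GRing.rterm t ->
  exists p : {mpoly K[n]}, forall y, GRing.eval (env y) t = p.@[y].
Proof.
elim: t => //=.
- move=> i _; case: (ltnP i n) => [lt_in|le_ni].
    by exists 'X_(Ordinal lt_in) => y; rewrite mevalXU -nth_env.
  by exists 0 => y; rewrite meval0 nth_default // /env size_codom card_ord.
- by move=> c _; exists c%:MP => y; rewrite mevalC.
- by move=> k _; exists k%:R%:MP => y; rewrite mevalC.
- move=> t IHt u IHu /andP[/IHt[p pE] /IHu[q qE]].
  by exists (p + q) => y; rewrite mevalD pE qE.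
- by move=> t IHt /IHt[p pE]; exists (- p) => y; rewrite mevalN pE.
- by move=> t IHt k /IHt[p pE]; exists (p *+ k) => y; rewrite mevalMn pE.
- move=> t IHt u IHu /andP[/IHt[p pE] /IHu[q qE]].
  by exists (p * q) => y; rewrite mevalM pE qE.
- by move=> t IHt k /IHt[p pE]; exists (p ^+ k) => y; rewrite rmorphXn /= pE.
Qed.

(** Each atomic formula is a polynomial equation, which either holds identically
    or fails off a hypersurface; so a quantifier-free formula has a constant truth
    value on the complement of a hypersurface. *)
Lemma qf_eval_generic (K : fieldType) n (f : GRing.formula K) :
  GRing.qf_form f && GRing.rformula f ->
  exists b, exists2 h : {mpoly K[n]}, h != 0 &
    forall y, h.@[y] != 0 -> GRing.qf_eval (env y) f = b.
Proof.
have nz1 : (1 : {mpoly K[n]}) != 0 by exact: oner_neq0.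
have bin (op : bool -> bool -> bool) f1 f2 :
  (GRing.qf_form f1 && GRing.rformula f1 -> exists b, exists2 h : {mpoly K[n]}, h != 0 &
    forall y, h.@[y] != 0 -> GRing.qf_eval (env y) f1 = b) ->
  (GRing.qf_form f2 && GRing.rformula f2 -> exists b, exists2 h : {mpoly K[n]}, h != 0 &
    forall y, h.@[y] != 0 -> GRing.qf_eval (env y) f2 = b) ->
  (GRing.qf_form f1 && GRing.qf_form f2) && (GRing.rformula f1 && GRing.rformula f2) ->
  exists b, exists2 h : {mpoly K[n]}, h != 0 & forall y, h.@[y] != 0 ->
    op (GRing.qf_eval (env y) f1) (GRing.qf_eval (env y) f2) = b.
  move=> IH1 IH2; rewrite andbACA => /andP[/IH1[b1 [h1 nz_h1 E1]] /IH2[b2 [h2 nz_h2 E2]]].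
  exists (op b1 b2), (h1 * h2); first by rewrite mulf_neq0.
  by move=> y; rewrite mevalM mulf_eq0 negb_or => /andP[/E1-> /E2->].
elim: f => //=.
- by move=> b _; exists b, 1.
- move=> t u /andP[/(mpoly_of_term n)[p pE] /(mpoly_of_term n)[q qE]].
  have [Epq|nz] := eqVneq p q.
    by exists true, 1 => // y _; rewrite pE qE Epq eqxx.
  exists false, (p - q); first by rewrite subr_eq0.
  by move=> y; rewrite mevalB subr_eq0 pE qE => /negPf.
- by move=> f1 IH1 f2 IH2; apply: (bin andb).
- by move=> f1 IH1 f2 IH2; apply: (bin orb).
- by move=> f1 IH1 f2 IH2; apply: (bin implb).
- move=> f1 IH1 /IH1[b [h nz_h E]]; exists (~~ b), h => // y /E->; by [].
Qed.

(** The condition [y = phi x] with [g x != 0] for some [x] is first-order, so by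
    elimination of quantifiers over an algebraically closed field it is generically
    true or generically false in [y]. *)
Lemma image_generic (K : closedFieldType) n N (g : {mpoly K[n]})
    (phi : 'I_N -> {mpoly K[n]}) :
  exists2 h : {mpoly K[N]}, h != 0 &
    (forall y, h.@[y] != 0 ->
       exists2 x, g.@[x] != 0 & forall i, y i = (phi i).@[x]) \/
    (forall x, g.@[x] != 0 -> h.@[fun i => (phi i).@[x]] = 0).
Proof.
(* the free variables 0 .. N-1 hold y, the quantified ones N .. N+n-1 hold x *)
pose idx (i : 'I_n) := (N + i)%N.
have [tg rg tgE] := term_of_mpoly idx g.
have /fin_all_exists2[tphi rphi tphiE] i := term_of_mpoly idx (phi i).
pose body := foldr (fun i f =>
  GRing.And (GRing.Equal (GRing.Var K (nat_of_ord i)) (tphi i)) f)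
  (GRing.Not (GRing.Equal tg (GRing.NatConst K 0))) (enum 'I_N).
pose F := foldr GRing.Exists body (iota N n).
have rbody : GRing.rformula body.
  by rewrite /body; elim: (enum _) => /= [|i s ->]; rewrite ?rg ?rphi.
have rF : GRing.rformula F by rewrite /F; elim: iota.
have bodyE e : GRing.holds e body <->
  g.@[fun i => e`_(idx i)] != 0 /\ forall i : 'I_N, e`_i = (phi i).@[fun j => e`_(idx j)].
  suff: GRing.holds e body <->
     g.@[fun i => e`_(idx i)] != 0 /\ {in enum 'I_N, forall i : 'I_N, e`_i = (phi i).@[fun j => e`_(idx j)]}.
    move=> ->; split=> -[-> H]; split=> // i; apply: H; exact: mem_enum.
  rewrite /body; elim: (enum _) => [|i s IH] /=.
    rewrite tgE; split=> [/eqP|[/eqP //]]; by split.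
  rewrite IH tphiE; split=> [[E [-> H]]|[-> H]].
    by split=> // j; rewrite inE => /predU1P[->|/H].
  split; first by apply: H; rewrite mem_head.
  by split=> // j js; apply: H; rewrite inE js orbT.
have FE y : GRing.holds (env y) F <->
  exists2 x, g.@[x] != 0 & forall i, y i = (phi i).@[x].
  rewrite -GRing.foldExistsP; split.
    case=> e ye /bodyE[ge pe]; exists (fun i => e`_(idx i)) => // i.
    by rewrite -pe -ye ?nth_env // !inE mem_iota leqNgt ltn_ord.
  case=> x gx px; exists (env y ++ env x).
    move=> i; rewrite !inE mem_iota negb_and -!ltnNge => H.
    rewrite nth_cat /env !size_codom !card_ord.
    case: ltnP => // le_Ni; rewrite ltnNge le_Ni /= ltnS in H.
    rewrite !nth_default // size_codom card_ord //.
    by rewrite leq_subRL.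
  have ex i : (env y ++ env x)`_(idx i) = x i.
    by rewrite nth_cat /env size_codom card_ord ltnNge leq_addr /= addKn nth_env.
  apply/bodyE; split; first by under meval_eq do rewrite ex.
  move=> i; under meval_eq do rewrite ex.
  by rewrite nth_cat /env size_codom card_ord ltn_ord -px nth_env.
have wf := @ClosedFieldQE.wf_ex_elim K.
have ok := ClosedFieldQE.holds_ex_elim (@GRing.solve_monicpoly K).
have [b [h h0 hE]] := qf_eval_generic N (GRing.quantifier_elim_wf wf rF).
have QE y := GRing.quantifier_elim_rformP wf ok (env y) rF.
exists h => //; case: b hE => hE; [left=> y /hE qy | right=> x gx].
  by apply/FE/QE.
apply/eqP/negPn/negP => /hE /QE[]; apply/FE; by exists x.
Qed.

(** * Dominant polynomial maps *)

Section PolyMap.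

Variables (K : fieldType) (n : nat).

(** A vector-valued polynomial map, kept as a finite sum of scalar polynomials times
    vectors so that the target may be infinite-dimensional. *)
Definition poly_map (A : lmodType K) (F : ('I_n -> K) -> A) :=
  exists s : seq ({mpoly K[n]} * A), forall x, F x = \sum_(q <- s) q.1.@[x] *: q.2.

Lemma poly_mapD (A : lmodType K) (F G : ('I_n -> K) -> A) :
  poly_map F -> poly_map G -> poly_map (fun x => F x + G x).
Proof. by move=> [s sE] [r rE]; exists (s ++ r) => x; rewrite big_cat sE rE. Qed.

Lemma poly_mapZ (A : lmodType K) (p : {mpoly K[n]}) (F : ('I_n -> K) -> A) :
  poly_map F -> poly_map (fun x => p.@[x] *: F x).
Proof.
move=> [s sE]; exists [seq (p * q.1, q.2) | q <- s] => x.
by rewrite sE big_map scaler_sumr; apply: eq_bigr => q _; rewrite mevalM scalerA.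
Qed.

Lemma poly_mapN (A : lmodType K) (F : ('I_n -> K) -> A) :
  poly_map F -> poly_map (fun x => - F x).
Proof.
move=> /(poly_mapZ (- 1)) [s sE]; exists s => x.
by rewrite -sE mevalN meval1 scaleN1r.
Qed.

Lemma poly_map_sum (A : lmodType K) m (F : 'I_m -> ('I_n -> K) -> A) :
  (forall i, poly_map (F i)) -> poly_map (fun x => \sum_i F i x).
Proof.
move=> /fin_all_exists[s sE]; exists (flatten [seq s i | i <- enum 'I_m]) => x.
by rewrite big_flatten big_map big_enum; apply: eq_bigr => i _; exact: sE.
Qed.

Lemma poly_map_cst (A : lmodType K) (u : A) : poly_map (fun _ => u).
Proof. by exists [:: (1, u)] => x; rewrite big_seq1 meval1 scale1r. Qed.

Lemma poly_mapM (A : algType K) (F G : ('I_n -> K) -> A) :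
  poly_map F -> poly_map G -> poly_map (fun x => F x * G x).
Proof.
move=> [s sE] [r rE]; exists [seq (p.1 * q.1, p.2 * q.2) | p <- s, q <- r] => x.
rewrite big_allpairs_dep sE rE mulr_suml; apply: eq_bigr => p _.
rewrite mulr_sumr; apply: eq_bigr => q _ /=.
by rewrite mevalM -scalerAl -scalerAr scalerA.
Qed.

Lemma poly_map_prod (A : algType K) m (F : 'I_m -> ('I_n -> K) -> A) :
  (forall i, poly_map (F i)) -> poly_map (fun x => \prod_i F i x).
Proof.
move=> HF; elim: m F HF => [|m IH] F HF.
  by case: (poly_map_cst (1 : A)) => s sE; exists s => x; rewrite big_ord0 -(sE x).
case: (poly_mapM (HF ord0) (IH _ (fun i => HF (lift ord0 i)))) => s sE.
by exists s => x; rewrite big_ord_recl sE.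
Qed.

Lemma poly_map_linear (A B : lmodType K) (f : {linear A -> B}) (F : ('I_n -> K) -> A) :
  poly_map F -> poly_map (fun x => f (F x)).
Proof.
move=> [s sE]; exists [seq (q.1, f q.2) | q <- s] => x.
by rewrite sE linear_sum big_map; apply: eq_bigr => q _; rewrite linearZ.
Qed.

End PolyMap.

(** It suffices to produce [P] on the image of a polynomial map [phi] whose image
    contains a curve through some point in every direction: such an image is
    Zariski dense, hence contains a nonempty open set. *)
Lemma generic_of_dominant (K : numClosedFieldType) (V : vectType K) n
    (g : {mpoly K[n]}) (phi : ('I_n -> K) -> V) (P : V -> Prop) :
  g != 0 ->
  poly_map phi ->
  (exists p0, forall w, exists (c : K -> 'I_n -> K) (s : seq V),
     forall t, phi (c t) = p0 + t *: w + \sum_(i < size s) t ^+ i.+2 *: s`_i) ->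
  (forall x, g.@[x] != 0 -> P (phi x)) -> generic P.
Proof.
move=> nz_g [s sE] [p0 curves] gP.
pose co i (v : V) : K := coord (vbasis fullv) i v.
have coK v : \sum_i co i v *: (vbasis fullv)`_i = v.
  by rewrite -coord_vbasis ?memvf.
have coD i u v : co i (u + v) = co i u + co i v by rewrite /co linearD.
have coZ i a v : co i (a *: v) = a * co i v by rewrite /co linearZ.
pose f i := \sum_(q <- s) co i q.2 *: q.1 : {mpoly K[n]}.
have fE i x : (f i).@[x] = co i (phi x).
  rewrite /f raddf_sum /co sE linear_sum; apply: eq_bigr => q _ /=.
  by rewrite mevalZ linearZ /= mulrC.
have [h nz_h [im_h|van_h]] := image_generic g f; last first.
  case/eqP: nz_h; apply: (@vanish_on_curves _ _ h (fun i => co i p0)) => w.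
  have [c [r cE]] := curves (\sum_i w i *: (vbasis fullv)`_i).
  pose cv i := (co i p0)%:P + (w i) *: 'X + \sum_(j < size r) co i r`_j *: 'X^(j.+2).
  have cow i : co i (\sum_j w j *: (vbasis fullv)`_j) = w i.
    by rewrite /co coord_sum_free ?(basis_free (vbasisP _)).
  exists cv; split=> [i|i|t].
  - rewrite !coefD coefC coefZ coefX mulr0 addr0 coef_sum big1 ?addr0 // => j _.
    by rewrite coefZ coefXn mulr0.
  - rewrite !coefD coefC coefZ coefX mulr1 add0r coef_sum big1 ?addr0 // => j _.
    by rewrite coefZ coefXn mulr0.
  (* h o phi vanishes where g does not, hence identically *)
  have hf0 : h \mPo [tuple f i | i < _] = 0.
    apply/eqP/negPn/negP => nz.
    have [x] := mpoly_nonvanishing (mulf_neq0 nz nz_g).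
    rewrite mevalM mulf_eq0 negb_or comp_mpoly_meval => /andP[+ /van_h E].
    by rewrite -E => /eqP[]; apply: meval_eq => i; rewrite tnth_mktuple.
  have <- : (h \mPo [tuple f i | i < _]).@[c t] = 0 by rewrite hf0 meval0.
  rewrite comp_mpoly_meval; apply: meval_eq => i.
  rewrite tnth_mktuple fE cE !coD coZ cow !hornerE horner_sum mulrC; congr (_ + _ + _).
  rewrite /co linear_sum /=; apply: eq_bigr => j _.
  by rewrite linearZ /= hornerZ hornerXn mulrC.
exists [set v | h.@[fun i => co i v] != 0]; split.
- exists [set h]; rewrite predeqE => v; split=> /= [/negP/negPn/eqP hv p -> //|H].
  by apply/negP/negPn/eqP; apply: H.
- have [y hy] := mpoly_nonvanishing nz_h.
  exists (\sum_i y i *: (vbasis fullv)`_i) => /=.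
  congr (_ != 0): hy; apply: meval_eq => i.
  by rewrite /co coord_sum_free ?(basis_free (vbasisP _)).
move=> v /= /im_h[x /gP Px vE]; suff -> : v = phi x by [].
by rewrite -[LHS]coK -[RHS]coK; apply: eq_bigr => i _; rewrite vE fE.
Qed.

(** * Lines on the sum of two products of three linear forms *)

Lemma dim_lker_cap (K : fieldType) (V : vectType K) (p q : 'Hom(V, K^o)) :
  (exists v, p v != 0) -> (exists2 v, p v = 0 & q v != 0) ->
  \dim (lker p :&: lker q) = (\dim {:V} - 2)%N.
Proof.
have dim1 (U : {vspace V}) (f : 'Hom(V, K^o)) :
    (exists2 v, v \in U & f v != 0) -> \dim (U :&: lker f) = (\dim U).-1.
  case=> v Uv fv; have /= := limg_ker_dim f U.
  suff -> : \dim (f @: U) = 1%N by move=> <-; rewrite addn1.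
  apply/eqP; rewrite eqn_leq; apply/andP; split.
    by apply: leq_trans (dimvS (subvf _)) _; rewrite dimvf.
  rewrite lt0n dimv_eq0; apply: contraNneq fv => fU0.
  by rewrite -memv0 -fU0 memv_img.
move=> [v pv] [w pw qw]; rewrite dim1; last by exists w; rewrite ?memv_ker ?pw.
rewrite -[lker p]capfv dim1; last by exists v; rewrite ?memvf.
by rewrite subn2.
Qed.

(** A vector space over an infinite field is not a finite union of proper
    subspaces; stated for kernels of linear forms. *)
Lemma avoid_kernels (K : numFieldType) (V : vectType K) (L : {vspace V})
    (s : seq 'Hom(V, K^o)) :
  (forall p, p \in s -> exists2 u, u \in L & p u != 0) ->
  exists2 w, w \in L & forall p, p \in s -> p w != 0.
Proof.
elim: s => [|p s IHs] H; first by exists 0; rewrite ?mem0v.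
have [q qs|w Lw sw] := IHs; first by apply: H; rewrite inE qs orbT.
have [u Lu pu] := H p (mem_head _ _).
pose P := \prod_(q <- p :: s) ((q w : K)%:P + (q u : K) *: 'X).
have /poly_nonvanishing[t] : P != 0.
  rewrite prodf_seq_neq0; apply/allP => q qs /=.
  apply/eqP => /polyP E; move: (E 0%N) (E 1%N).
  rewrite !coefD !coefC !coefZ !coefX mulr0 addr0 mulr1 add0r => qw qu.
  move: qs; rewrite inE => /predU1P[qp|/sw]; last by rewrite qw eqxx.
  by rewrite -qp qu eqxx in pu.
rewrite horner_prod prodf_seq_neq0 => /allP nz.
exists (w + t *: u); first by rewrite memvD ?memvZ.
move=> q /nz /=; rewrite !hornerE linearD linearZ /=.
by rewrite [_ *: _]mulrC.
Qed.

Lemma ord3_ind (P : 'I_3 -> Prop) : P ord0 -> P (lift ord0 ord0) ->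
  P (lift ord0 (lift ord0 ord0)) -> forall i, P i.
Proof.
move=> P0 P1 P2 [[|[|[|//]]] lt_i].
- by have <- : ord0 = Ordinal lt_i by apply: val_inj.
- by have <- : lift ord0 ord0 = Ordinal lt_i by apply: val_inj.
- by have <- : lift ord0 (lift ord0 ord0) = Ordinal lt_i by apply: val_inj.
Qed.

(** The planes of K^3 orthogonal to (1,1,1) and to [r] meet in a line, as [r] is not
    proportional to (1,1,1); so [e] and [g] are proportional. *)
Lemma parallel_of_orthogonal (K : idomainType) (r e g : 'I_3 -> K) :
  ~ (forall i j, r i = r j) ->
  \sum_i e i = 0 -> \sum_i r i * e i = 0 -> \sum_i g i = 0 -> \sum_i r i * g i = 0 ->
  forall i, g ord0 * e i = e ord0 * g i.
Proof.
pose i1 : 'I_3 := lift ord0 ord0; pose i2 : 'I_3 := lift ord0 (lift ord0 ord0).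
rewrite !big_ord_recl !big_ord0 -/i1 -/i2 !addr0 => nr e0 re g0 rg.
have e2 : e i2 = - e ord0 - e i1 by rewrite -[LHS](addr0) -oppr0 -e0; ring.
have g2 : g i2 = - g ord0 - g i1 by rewrite -[LHS](addr0) -oppr0 -g0; ring.
suff M : g ord0 * e i1 = e ord0 * g i1.
  apply: ord3_ind => //; first exact: mulrC.
  by rewrite e2 g2 !mulrBr M !mulrN (mulrC (g _) (e _)).
rewrite e2 in re; rewrite g2 in rg.
have F1 : (g ord0 * e i1 - e ord0 * g i1) * (r ord0 - r i2) = 0.
  transitivity (e i1 * 0 - g i1 * (0 : K)); last by rewrite !mulr0 subr0.
  by rewrite -{1}rg -re; ring.
have F2 : (g ord0 * e i1 - e ord0 * g i1) * (r i1 - r i2) = 0.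
  transitivity (g ord0 * 0 - e ord0 * (0 : K)); last by rewrite !mulr0 subr0.
  by rewrite -{1}re -rg; ring.
apply/eqP; rewrite -subr_eq0; apply/negPn/negP => nz; case: nr.
have R0 : r ord0 = r i2.
  by apply/eqP; rewrite -subr_eq0; move/eqP: F1; rewrite mulf_eq0 (negPf nz).
have R1 : r i1 = r i2.
  by apply/eqP; rewrite -subr_eq0; move/eqP: F2; rewrite mulf_eq0 (negPf nz).
have R : forall i, r i = r i2 by apply: ord3_ind.
by move=> i j; rewrite !R.
Qed.

Section Trihedral.

Variables (K : numFieldType) (V : vectType K).
Variables (y : 'I_3 + 'I_3 -> 'Hom(V, K^o)) (a : 'I_3 + 'I_3 -> K).
Hypothesis dimV : \dim {:V} = 4%N.
Hypothesis a_inj : injective a.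
Hypothesis sum_y : forall v, \sum_k (y k v : K) = 0.
Hypothesis sum_ay : forall v, \sum_k a k * y k v = 0.
Hypothesis y_onto : forall z : 'I_3 + 'I_3 -> K,
  \sum_k z k = 0 -> \sum_k a k * z k = 0 -> exists v, forall k, y k v = z k.
Hypothesis y_inj : forall v, (forall k, y k v = 0) -> v = 0.

(** Any four of the six forms are coordinates: the values at the remaining indices
    [k] and [l] solve a linear system of determinant [a l - a k]. *)
Lemma prescribe (A : {set 'I_3 + 'I_3}) (z : 'I_3 + 'I_3 -> K) :
  (#|A| <= 4)%N -> exists v, {in A, forall k, y k v = z k}.
Proof.
move=> A4; have /card_gt1P[k [l [kA lA kl]]] : (1 < #|~: A|)%N.
  have := cardsC A; rewrite card_sum !card_ord => E.
  by rewrite -(ltn_add2l #|A|) E addn1 ltnS (leq_ltn_trans A4).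
rewrite !inE in kA lA.
have akl : a k - a l != 0 by rewrite subr_eq0; apply: contraNneq kl => /a_inj ->.
pose S0 := \sum_(j | (j != k) && (j != l)) z j.
pose S1 := \sum_(j | (j != k) && (j != l)) a j * z j.
pose zk := (a l * S0 - S1) / (a k - a l).
pose z' j := if j == k then zk else if j == l then - S0 - zk else z j.
have z'E (c : 'I_3 + 'I_3 -> K) : \sum_j c j * z' j =
   c k * zk + (c l * (- S0 - zk) + \sum_(j | (j != k) && (j != l)) c j * z j).
  rewrite (bigD1 k) //= (bigD1 l) ?(eq_sym l) //= /z' !eqxx (eq_sym l).
  rewrite (negPf kl); congr (_ + (_ + _)).
  by apply: eq_bigr => j /andP[/negPf-> /negPf->].
have [v vE] : exists v, forall j, y j v = z' j.
  apply: y_onto.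
    have := z'E (fun=> 1); under eq_bigr do rewrite mul1r.
    under [in RHS]eq_bigr do rewrite mul1r.
    by move=> ->; rewrite -/S0; ring.
  by rewrite z'E -/S1 /zk; field.
exists v => j jA; rewrite vE /z'.
case: eqP => [jk|_]; first by rewrite -jk jA in kA.
by case: eqP => // jl; rewrite -jl jA in lA.
Qed.

Definition cubic_vanishes (L : {vspace V}) := forall v, v \in L ->
  \prod_i (y (inl i) v : K) + \prod_j (y (inr j) v : K) = 0.

Definition base_line (i j : 'I_3) := (lker (y (inl i)) :&: lker (y (inr j)))%VS.

Lemma base_lineP i j v :
  reflect (y (inl i) v = 0 /\ y (inr j) v = 0) (v \in base_line i j).
Proof.
rewrite memv_cap !memv_ker.
by apply: (iffP andP) => -[/eqP-> /eqP->].
Qed.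

Lemma dim_base_line i j : \dim (base_line i j) = 2%N.
Proof.
have P k : exists v, {in [set inl i; inr j]%SET, forall l, y l v = (l == k)%:R :> K}.
  have [|v vE] := @prescribe [set inl i; inr j] (fun l => (l == k)%:R).
    by rewrite cards2; case: eqP.
  by exists v.
rewrite /base_line dim_lker_cap ?dimV //.
  by have [v vE] := P (inl i); exists v; rewrite vE ?inE ?eqxx ?oner_neq0.
have [v vE] := P (inr j); exists v; rewrite vE ?inE ?eqxx ?orbT //.
exact: oner_neq0.
Qed.

Lemma base_line_vanishes i j : cubic_vanishes (base_line i j).
Proof.
move=> v /base_lineP[yi yj].
by rewrite (bigD1 i) //= yi mul0r (bigD1 j) //= yj mul0r addr0.
Qed.

Lemma base_line_inj i j i' j' : base_line i j = base_line i' j' -> i = i' /\ j = j'.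
Proof.
move=> E.
have P k : exists v, {in [set inl i; inr j; k]%SET, forall l, y l v = (l == k)%:R :> K}.
  have [|v vE] := @prescribe [set inl i; inr j; k] (fun l => (l == k)%:R).
    by rewrite finset.setUC cardsU1 cards2; case: (_ \notin _); case: (_ == _).
  by exists v.
split; apply/eqP/negPn/negP => ne.
  have [v vE] := P (inl i').
  have : v \in base_line i j.
    apply/base_lineP; rewrite !vE ?inE ?eqxx ?orbT //=; split=> //.
    by rewrite -[inl i == _]/(i == i') (negPf ne).
  rewrite E => /base_lineP[+ _]; rewrite vE ?inE ?eqxx ?orbT // => /eqP.
  by rewrite oner_eq0.
have [v vE] := P (inr j').
have : v \in base_line i j.
  apply/base_lineP; rewrite !vE ?inE ?eqxx ?orbT //=; split=> //.
  by rewrite -[inr j == _]/(j == j') (negPf ne).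
rewrite E => /base_lineP[_ +]; rewrite vE ?inE ?eqxx ?orbT // => /eqP.
by rewrite oner_eq0.
Qed.

(** The coefficient of [y k] in the member of the pencil spanned by the relations
    [sum_y] and [sum_ay] that has coordinates [r]. *)
Definition rel_coef (r : K * K) k := r.1 + r.2 * a k.

(** [r] is a root of the binary cubic that decides whether the relation of
    coefficients [rel_coef r] produces lines of the surface. *)
Definition balanced (r : K * K) :=
  \prod_i rel_coef r (inl i) = \prod_j rel_coef r (inr j).

(** One vanishing coefficient forces another one in the other triple, and a
    nontrivial relation has at most one zero coefficient, the [a k] being distinct. *)
Lemma rel_coef_neq0 r k : r != 0 -> balanced r -> rel_coef r k != 0.
Proof.
move=> r0 bal; apply: contraNneq r0 => rk.
suff [l lk rl] : exists2 l, l != k & rel_coef r l = 0.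
  have r2 : r.2 = 0.
    apply/eqP; have : r.2 * (a l - a k) == 0.
      apply/eqP; transitivity (rel_coef r l - rel_coef r k); last by rewrite rk rl subr0.
      by rewrite /rel_coef; ring.
    by rewrite mulf_eq0 subr_eq0 (inj_eq a_inj) (negPf lk) orbF.
  by move: rk; rewrite /rel_coef r2 mul0r addr0; case: r r2 {bal rl} => r1 ? /= -> ->.
move: bal; rewrite /balanced; case: k rk => k rk.
  rewrite (bigD1 k) //= rk mul0r => /esym/eqP/prodf_eq0[l _ /eqP rl].
  by exists (inr l).
rewrite [RHS](bigD1 k) //= rk mul0r => /eqP/prodf_eq0[l _ /eqP rl].
by exists (inl l).
Qed.

Definition pair_form r (s : {perm 'I_3}) i : 'Hom(V, K^o) :=
  rel_coef r (inl i) *: y (inl i) + rel_coef r (inr (s i)) *: y (inr (s i)).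

Lemma pair_formE r s i v : pair_form r s i v =
  rel_coef r (inl i) * y (inl i) v + rel_coef r (inr (s i)) * y (inr (s i)) v.
Proof. by rewrite /pair_form add_lfunE !scale_lfunE. Qed.

Lemma sum_pair_form r s v : \sum_i (pair_form r s i v : K) = 0.
Proof.
transitivity (r.1 * \sum_k (y k v : K) + r.2 * \sum_k a k * y k v); last first.
  by rewrite sum_y sum_ay !mulr0 addr0.
rewrite !mulr_sumr -big_split /= big_sumType /= [X in _ = _ + X](reindex_inj (@perm_inj _ s)) /=.
rewrite -big_split; apply: eq_bigr => i _.
by rewrite pair_formE /rel_coef /=; ring.
Qed.

(** The three forms [pair_form r s i] have sum zero, so two of them suffice. *)
Definition cross_line r s :=
  (lker (pair_form r s ord0) :&: lker (pair_form r s (lift ord0 ord0)))%VS.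

Lemma cross_lineP r s v :
  reflect (forall i, pair_form r s i v = 0) (v \in cross_line r s).
Proof.
rewrite memv_cap !memv_ker; apply: (iffP andP) => [[/eqP p0 /eqP p1] i|E]; last by rewrite !E.
have := sum_pair_form r s v; rewrite !big_ord_recl big_ord0 p0 p1 !add0r addr0 => p2.
case: i => [[|[|[|//]]] lt_i].
- by rewrite -p0; congr (pair_form r s _ v); apply: val_inj.
- by rewrite -p1; congr (pair_form r s _ v); apply: val_inj.
- by rewrite -[RHS]p2; congr (pair_form r s _ v); apply: val_inj.
Qed.

Section CrossLine.

Variables (r : K * K) (s : {perm 'I_3}).
Hypotheses (r_neq0 : r != 0) (r_bal : balanced r).

(** On a cross line the two pairs indexed by [i] and [i'] are independent: the point
    found here has the second pair zero and the first one nonzero.  These points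
    tell all the lines apart. *)
Lemma cross_line_witness i i' : i != i' -> exists v,
  [/\ v \in cross_line r s, y (inl i) v = (rel_coef r (inl i))^-1,
      y (inr (s i)) v = - (rel_coef r (inr (s i)))^-1 &
      y (inl i') v = 0 /\ y (inr (s i')) v = 0].
Proof.
move=> ii'; pose z k : K := match k with
  | inl j => (j == i)%:R * (rel_coef r (inl i))^-1
  | inr j => - ((j == s i)%:R * (rel_coef r (inr (s i)))^-1) end.
have [|v vE] := @prescribe [set inl i; inl i'; inr (s i); inr (s i')] z.
  apply: leq_trans (leq_card_setU _ _) _; rewrite cards1 addn1.
  apply: leq_trans (leq_card_setU _ _) _; rewrite cards1 addn1.
  by rewrite cards2; case: (_ != _).
have yi : y (inl i) v = (rel_coef r (inl i))^-1.
  by rewrite vE ?inE ?eqxx // /z eqxx mul1r.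
have ysi : y (inr (s i)) v = - (rel_coef r (inr (s i)))^-1.
  by rewrite vE ?inE ?eqxx ?orbT // /z eqxx mul1r.
have yi' : y (inl i') v = 0.
  by rewrite vE ?inE ?eqxx ?orbT // /z eq_sym (negPf ii') mul0r.
have ysi' : y (inr (s i')) v = 0.
  by rewrite vE ?inE ?eqxx ?orbT // /z (inj_eq perm_inj) eq_sym (negPf ii') mul0r oppr0.
exists v; split=> //.
have fi : pair_form r s i v = 0.
  by rewrite pair_formE yi ysi mulrN !mulfV ?subrr ?rel_coef_neq0.
have fi' : pair_form r s i' v = 0 by rewrite pair_formE yi' ysi' !mulr0 addr0.
apply/cross_lineP => j; have := sum_pair_form r s v.
rewrite (bigD1 i) //= (bigD1 i') 1?eq_sym //= fi fi' !add0r.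
case: (eqVneq j i) => [-> //|ji]; case: (eqVneq j i') => [-> //|ji'].
rewrite (bigD1 j) ?ji ?ji' //= big1 ?addr0 // => l /andP[/andP[li li'] lj].
have /card_uniqP E : uniq [:: l; i; i'; j].
  by rewrite /= !inE !negb_or li li' lj ii' (eq_sym i j) ji (eq_sym i' j) ji'.
by have := max_card (mem [:: l; i; i'; j]); rewrite E card_ord.
Qed.

Lemma dim_cross_line : \dim (cross_line r s) = 2%N.
Proof.
pose i1 : 'I_3 := lift ord0 ord0.
rewrite /cross_line dim_lker_cap ?dimV //.
  have [|v vE] := @prescribe [set inl ord0; inr (s ord0)] (fun l => (l == inl ord0)%:R).
    by rewrite cards2; case: eqP.
  exists v; rewrite pair_formE !vE ?inE ?eqxx ?orbT //= mulr1 mulr0 addr0.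
  exact: rel_coef_neq0.
have [|v vE] := @prescribe [set inl i1; inl ord0; inr (s i1); inr (s ord0)] (fun l => (l == inl i1)%:R).
  apply: leq_trans (leq_card_setU _ _) _; rewrite cards1 addn1.
  apply: leq_trans (leq_card_setU _ _) _; rewrite cards1 addn1.
  by rewrite cards2; case: (_ != _).
exists v; rewrite pair_formE !vE ?inE ?eqxx ?orbT //= ?mulr1 ?mulr0 ?addr0 //.
exact: rel_coef_neq0.
Qed.

(** On the line, [c_i y_i = - c'_(s i) y'_(s i)]; multiply the three equations and
    cancel the common product of coefficients. *)
Lemma cross_line_vanishes : cubic_vanishes (cross_line r s).
Proof.
move=> v /cross_lineP vE.
have E i : rel_coef r (inl i) * y (inl i) v = - (rel_coef r (inr (s i)) * y (inr (s i)) v).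
  by apply/eqP; rewrite -addr_eq0 -pair_formE vE.
have nz : \prod_i rel_coef r (inl i) != 0.
  by apply/prodf_neq0 => i _; apply: rel_coef_neq0.
apply: (mulfI nz); rewrite mulr0 mulrDr -[in X in X + _]big_split /=.
rewrite r_bal -[in X in _ + X]big_split /=.
under eq_bigr do rewrite E.
rewrite prodrN card_ord [X in _ + X](reindex_inj (@perm_inj _ s)) /=.
by rewrite -signr_odd expr1 mulN1r addNr.
Qed.

Lemma cross_line_neq_base i j : cross_line r s != base_line i j.
Proof.
have [i' ii'] : exists i', i != i'.
  case: (eqVneq i ord0) => [->|]; last by exists ord0.
  by exists (lift ord0 ord0).
have [v [vL yi _ _]] := cross_line_witness ii'.
apply: contraTneq vL => ->; apply/base_lineP; rewrite yi => -[/eqP].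
by rewrite invr_eq0 (negPf (rel_coef_neq0 _ _ _)).
Qed.

End CrossLine.

(** If [s i' = s' i'] fails, the point where the [s]-pair of [i'] vanishes but
    [y (inr (s' i'))] does not is on the first line only.  Once the permutations
    agree, the ratio of [y (inl i)] to [y (inr (s i))] on the line determines [r] up to
    scaling. *)
Lemma cross_line_inj r s r' s' :
  r != 0 -> balanced r -> cross_line r s = cross_line r' s' ->
  r' != 0 -> balanced r' -> s = s' /\ r.1 * r'.2 = r'.1 * r.2.
Proof.
move=> r0 rb E r'0 r'b.
have ss : s = s'.
  apply/permP => i'; apply/eqP/negPn/negP => ne.
  pose i := (s^-1)%g (s' i'); have si : s i = s' i' by rewrite /i permKV.
  have ii' : i != i' by apply: contraNneq ne => ii; rewrite -si ii.
  have [v [vL _ ysi [yi' _]]] := cross_line_witness s r0 rb ii'.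
  move: vL; rewrite E => /cross_lineP/(_ i'); rewrite pair_formE yi' mulr0 add0r -si ysi.
  move/eqP; rewrite mulf_eq0 oppr_eq0 invr_eq0 !(negPf (rel_coef_neq0 _ _ _)) //.
split=> //; rewrite -{s'}ss in E.
have [v [vL yi ysi _]] := cross_line_witness (i := ord0) (i' := lift ord0 ord0) s r0 rb isT.
move: vL; rewrite E => /cross_lineP/(_ ord0); rewrite pair_formE yi ysi.
set k := inl _; set l := inr _ => F.
have kl : k != l by [].
have rk : rel_coef r k != 0 by apply: rel_coef_neq0.
have rl : rel_coef r l != 0 by apply: rel_coef_neq0.
have : (r.1 * r'.2 - r'.1 * r.2) * (a k - a l) == 0.
  apply/eqP; transitivity (rel_coef r k * rel_coef r l * (0 : K)); last by rewrite mulr0.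
  rewrite -[in RHS]F; transitivity (rel_coef r' k * rel_coef r l - rel_coef r' l * rel_coef r k).
    by rewrite /rel_coef; ring.
  by field; rewrite rk rl.
by rewrite mulf_eq0 !subr_eq0 (inj_eq a_inj) (negPf kl) orbF => /eqP.
Qed.

(** If a form of one triple vanishes on [L], so does the product of the other triple,
    hence one of its factors. *)
Lemma base_line_complete L : \dim L = 2%N -> cubic_vanishes L ->
  (exists k, forall v, v \in L -> y k v = 0) -> exists i j, L = base_line i j.
Proof.
move=> dL cL [k yk].
have zero_form (e : 'I_3 -> 'I_3 + 'I_3) :
    (forall v, v \in L -> \prod_i (y (e i) v : K) = 0) ->
    exists i, forall v, v \in L -> y (e i) v = 0.
  move=> P0; apply: contrapT => H.
  have [p|w Lw] := @avoid_kernels _ _ L [seq y (e i) | i <- enum 'I_3].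
    case/mapP => i _ ->; have /existsNP[v /not_implyP[Lv yv]] : ~ forall v, v \in L -> y (e i) v = 0.
      by move=> yi; apply: H; exists i.
    by exists v => //; apply/eqP.
  move=> nz; move/eqP: (P0 _ Lw) => /prodf_eq0[i _]; apply/negP/nz/map_f.
  exact: mem_enum.
have [i [j [yi yj]]] : exists i j, (forall v, v \in L -> y (inl i) v = 0) /\
    (forall v, v \in L -> y (inr j) v = 0).
  case: k yk => k yk.
    have [|j yj] := zero_form inr; last by exists k, j.
    by move=> v Lv; have := cL _ Lv; rewrite (bigD1 k) //= yk // mul0r add0r.
  have [|j yj] := zero_form inl; last by exists j, k.
  by move=> v Lv; have := cL _ Lv; rewrite [X in _ + X](bigD1 k) //= yk // mul0r addr0.
exists i, j; apply/eqP; rewrite eqEdim dim_base_line dL leqnn andbT.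
by apply/subvP => v Lv; apply/base_lineP; rewrite yi // yj.
Qed.

(** Restricted to [L] the two products are, up to sign, two factorisations of one
    binary cubic into linear factors, so the factors are proportional in pairs. *)
Lemma proportional_pairs L : \dim L = 2%N -> cubic_vanishes L ->
  (forall k, exists2 v, v \in L & y k v != 0) ->
  exists w u (s : {perm 'I_3}),
    [/\ w \in L, forall k, y k w != 0, L = (<[w]> + <[u]>)%VS, u \notin <[w]>%VS &
        forall i, y (inl i) u * y (inr (s i)) w = y (inr (s i)) u * y (inl i) w].
Proof.
move=> dL cL nzL.
have [p /mapP[k _ ->]|w Lw nzw] := @avoid_kernels _ _ L [seq y k | k <- enum {: 'I_3 + 'I_3}].
  exact: nzL.
have {}nzw k : y k w != 0 by apply/nzw/map_f; rewrite mem_enum.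
have w0 : w != 0 by apply: contraNneq (nzw (inl ord0)) => ->; rewrite linear0.
have [u Lu uw] : exists2 u, u \in L & u \notin <[w]>%VS.
  apply/subvPn; apply/negP => /dimvS; by rewrite dL dim_vline w0.
have u0 : u != 0 by apply: contraNneq uw => ->; rewrite mem0v.
have LE : L = (<[w]> + <[u]>)%VS.
  apply/eqP; rewrite eq_sym eqEdim subv_add -!memvE Lw Lu dL /=.
  rewrite dimv_disjoint_sum ?dim_vline ?w0 ?u0 //.
  apply/eqP; rewrite -subv0; apply/subvP => v; rewrite memv_cap memv0.
  case/andP=> vw /vlineP[c vE]; rewrite vE scaler_eq0 (negPf u0) orbF.
  by apply: contraNT uw => c0; have := memvZ c^-1 vw; rewrite vE scalerA mulVf // scale1r.
pose d k : K := y k w; pose r k : K := y k u / d k.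
(* y k (t w - u) is linear in t with leading coefficient d k and root r k *)
have yE k t : y k (t *: w - u) = d k * (t - r k) :> K.
  by rewrite linearB linearZ /= /r mulrBr mulrCA divff ?mulr1 ?nzw // mulrC.
have D0 : \prod_i d (inl i) != 0 by apply/prodf_neq0 => i _; exact: nzw.
have DE : \prod_j d (inr j) = - \prod_i d (inl i).
  by apply/eqP; rewrite -addr_eq0 addrC; apply/eqP/cL.
have PE : \prod_i ('X - (r (inl i))%:P) = \prod_j ('X - (r (inr j))%:P).
  apply/eqP; rewrite -subr_eq0; apply/negPn/negP => /poly_nonvanishing[t]; case/eqP.
  have hE (e : 'I_3 -> 'I_3 + 'I_3) :
      \prod_i d (e i) * (\prod_i ('X - (r (e i))%:P)).[t] = \prod_i (y (e i) (t *: w - u) : K).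
    by rewrite horner_prod -big_split; apply: eq_bigr => i _; rewrite /= yE !hornerE.
  apply: (mulfI D0); rewrite mulr0 hornerD hornerN mulrBr -mulNr -DE !hE.
  by apply: cL; rewrite memvB ?memvZ.
have [s rs] : exists s : {perm 'I_3}, forall i, r (inl i) = r (inr (s i)).
  have /prod_XsubC_eq : \prod_(x <- [tuple r (inl i) | i < 3]) ('X - x%:P) =
      \prod_(x <- [tuple r (inr j) | j < 3]) ('X - x%:P).
    by rewrite !big_map -!enumT !big_enum.
  case/tuple_permP => s E; exists s => i.
  have : nth 0 [tuple r (inl i) | i < 3] i = nth 0 [tuple r (inr j) | j < 3] (s i).
    by rewrite E -tnth_nth tnth_mktuple -tnth_nth.
  by rewrite -!tnth_nth !tnth_mktuple.
exists w, u, s; split=> // i; have := rs i; rewrite /r => /eqP.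
by rewrite eqr_div ?nzw // => /eqP.
Qed.

(** Let [w], [u] be a basis of [L] and [q i] the ratio of the values at [u] and [w],
    common to the two forms of the i-th pair.  The two relations among the six forms,
    evaluated at [w] and [u], say that the vectors [e] and [g] below are orthogonal to
    (1,1,1) and to [q].  So they are proportional, and the proportionality is the
    relation sought. *)
Lemma cross_line_complete L : \dim L = 2%N -> cubic_vanishes L ->
  (forall k, exists2 v, v \in L & y k v != 0) ->
  exists r s, [/\ r != 0, balanced r &
    forall v, v \in L -> forall i, pair_form r s i v = 0].
Proof.
move=> dL cL /(proportional_pairs dL cL)[w [u [s [Lw nzw LE uw prop]]]].
pose d k : K := y k w.
pose e i := d (inl i) + d (inr (s i)).
pose g i := a (inl i) * d (inl i) + a (inr (s i)) * d (inr (s i)).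
pose q i : K := y (inl i) u / d (inl i).
have yu k i : k = inl i \/ k = inr (s i) -> y k u = q i * d k :> K.
  case=> ->; rewrite /q /d; first by rewrite mulfVK.
  by rewrite mulrAC prop mulfK.
have sumE (c : 'I_3 + 'I_3 -> K) : \sum_k c k = \sum_i (c (inl i) + c (inr (s i))).
  by rewrite big_sumType /= [X in _ + X](reindex_inj (@perm_inj _ s)) -big_split.
have nq : ~ (forall i j, q i = q j).
  move=> qE; case/negP: uw; apply/vlineP; exists (q ord0).
  apply/eqP; rewrite -subr_eq0; apply/eqP/y_inj => k.
  rewrite linearB linearZ /=; apply/eqP; rewrite subr_eq0; apply/eqP.
  case: k => i; first by rewrite (yu _ i) ?(qE i ord0) //; left.
  by rewrite (yu _ ((s^-1)%g i)) ?(qE _ ord0) //; right; rewrite permKV.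
have par := @parallel_of_orthogonal K q e g nq.
(* the relation s_0 e + s_1 g = 0 with (s_0, s_1) = (g_0, - e_0) *)
exists (g ord0, - e ord0), s.
have pe i : (g ord0 - e ord0 * a (inl i)) * d (inl i) + (g ord0 - e ord0 * a (inr (s i))) * d (inr (s i)) = 0.
  transitivity (g ord0 * e i - e ord0 * g i); first by rewrite [e i]/e [g i]/g; ring.
  apply/eqP; rewrite subr_eq0; apply/eqP/par.
  - by rewrite -[RHS](sum_y w) sumE.
  - rewrite -[RHS](sum_y u) sumE; apply: eq_bigr => j _.
    by rewrite (yu _ j) ?(yu (inr _) j); [rewrite /e; ring|right|left].
  - by rewrite -[RHS](sum_ay w) sumE.
  - rewrite -[RHS](sum_ay u) sumE; apply: eq_bigr => j _.
    by rewrite (yu _ j) ?(yu (inr _) j); [rewrite /g; ring|right|left].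
have rE k : rel_coef (g ord0, - e ord0) k = g ord0 - e ord0 * a k.
  by rewrite /rel_coef /= mulNr.
split.
- apply/eqP => -[g0 /eqP]; rewrite oppr_eq0 => /eqP e0.
  have : (a (inl ord0) - a (inr (s ord0))) * d (inl ord0) == 0.
    apply/eqP; transitivity (g ord0 - a (inr (s ord0)) * e ord0); first by rewrite /g /e; ring.
    by rewrite g0 e0 mulr0 subr0.
  by rewrite mulf_eq0 subr_eq0 (inj_eq a_inj) (negPf (nzw _)).
- have nz : \prod_i d (inl i) != 0 by apply/prodf_neq0 => i _; exact: nzw.
  have DE : \prod_i d (inl i) = - \prod_j d (inr j).
    by apply/eqP; rewrite -addr_eq0; apply/eqP/cL.
  apply: (mulIf nz); rewrite [in RHS]DE mulrN -!big_split /=.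
  rewrite [in RHS](reindex_inj (@perm_inj _ s)) /=.
  transitivity (\prod_i - (rel_coef (g ord0, - e ord0) (inr (s i)) * d (inr (s i)))).
    by apply: eq_bigr => i _; apply/eqP; rewrite -addr_eq0 !rE pe.
  by rewrite prodrN card_ord -signr_odd expr1 mulN1r.
move=> v; rewrite LE => /memv_addP[v1 /vlineP[c1 ->] [v2 /vlineP[c2 ->] ->]] i.
rewrite linearD !linearZ /= !pair_formE !rE.
rewrite (yu _ i) ?(yu (inr _) i); [|by right|by left].
rewrite -/(d _) -/(d _) [X in _ + c2 *: X](_ : _ = q i * 0); last first.
  by rewrite -(pe i); ring.
by rewrite pe mulr0 !scaler0 addr0.
Qed.

(** There are 3 * 3 base lines, and one cross line for each of the three roots
    [rho i] and each of the six permutations. *)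
Lemma lines_of_trihedral_cubic (rho : 'I_3 -> K * K) :
  (forall i, rho i != 0) -> (forall i, balanced (rho i)) ->
  (forall i j, (rho i).1 * (rho j).2 = (rho j).1 * (rho i).2 -> i = j) ->
  (forall r, r != 0 -> balanced r ->
     exists i c, r.1 = c * (rho i).1 /\ r.2 = c * (rho i).2) ->
  ([set L : {vspace V} | \dim L = 2%N /\ cubic_vanishes L] #= `I_27)%card.
Proof.
move=> rho0 rhob rho_inj rho_all.
pose line (t : 'I_3 * 'I_3 + {perm 'I_3} * 'I_3) := match t with
  | inl p => base_line p.1 p.2 | inr p => cross_line (rho p.2) p.1 end.
have line_inj : injective line.
  move=> [[i j]|[s i]] [[i' j']|[s' i']] //= E.
  - by have [-> ->] := base_line_inj E.
  - by case/eqP: (cross_line_neq_base s' (rho0 i') (rhob i') i j).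
  - by case/eqP: (cross_line_neq_base s (rho0 i) (rhob i) i' j').
  - have [-> R] := cross_line_inj (rho0 i) (rhob i) E (rho0 i') (rhob i').
    by rewrite (rho_inj _ _ R).
have -> : [set L : {vspace V} | \dim L = 2%N /\ cubic_vanishes L] = range line.
  apply/seteqP; split=> [L [dL cL]|_ [t _ <-]] /=; last first.
    case: t => [[i j]|[s i]] /=; first by split; [apply: dim_base_line|apply: base_line_vanishes].
    by split; [apply: dim_cross_line|apply: cross_line_vanishes].
  case: (pselect (forall k, exists2 v, v \in L & y k v != 0)) => [nz|H].
    have [r [s [r0 rb rL]]] := cross_line_complete dL cL nz.
    have [i [c [r1 r2]]] := rho_all r r0 rb.
    exists (inr (s, i)) => //=; apply/esym/eqP.
    rewrite eqEdim dim_cross_line // dL leqnn andbT; apply/subvP => v Lv.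
    have c0 : c != 0.
      by apply: contraNneq r0 => c0; case: r r1 r2 {rb rL} => x z /= -> ->; rewrite c0 !mul0r.
    have rE k : rel_coef r k = c * rel_coef (rho i) k.
      by rewrite /rel_coef r1 r2 mulrDr mulrA.
    apply/cross_lineP => j; apply: (mulfI c0); rewrite mulr0 -(rL v Lv j) !pair_formE.
    by rewrite !rE; ring.
  have [i [j LE]] : exists i j, L = base_line i j; last by exists (inl (i, j)).
  apply: base_line_complete => //; apply: contrapT => nk; apply: H => k.
  apply: contrapT => nv; apply: nk; exists k => v Lv; apply: contrapT => yv.
  by apply: nv; exists v => //; apply/eqP.
pose T := ('I_3 * 'I_3 + {perm 'I_3} * 'I_3)%type.
have cT : #|{: T}| = 27%N by rewrite card_sum !card_prod card_Sn !card_ord.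
have -> : range line = [set line (enum_val k) | k in [set: 'I_#|{: T}|]].
  apply/seteqP; split=> [_ [t _ <-]|_ [k _ <-]]; last by exists (enum_val k).
  by exists (enum_rank t); rewrite ?enum_rankK.
apply: card_eq_trans (inj_card_eq _) _; first by move=> k l _ _ /line_inj/enum_val_inj.
by rewrite -cT card_eq_sym card_II.
Qed.

End Trihedral.

(** * Projective lines as two-dimensional subspaces *)

(** A subspace is determined by its projective points. *)
Lemma card_lines_in (K : fieldType) n d (f : hpoly K n d) :
  (lines_in (hypersurface f) #= [set L : {vspace 'rV[K]_n.+1} |
     \dim L = 2%N /\ forall v, v \in L -> (f : {mpoly K[n.+1]}).@[v 0] = 0])%card.
Proof.
pose pts (L : {vspace 'rV[K]_n.+1}) := [set x : proj_space K n | (sval x <= L)%VS].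
have line_point (v : 'rV[K]_n.+1) : v != 0 -> exists x : proj_space K n, sval x = <[v]>%VS.
  by move=> v0; have dv : \dim <[v]> == 1%N by [rewrite dim_vline v0]; exists (exist _ <[v]>%VS dv).
have pts_sub L L' : pts L `<=` pts L' -> (L <= L')%VS.
  move=> LL'; apply/subvP => v Lv; have [->|/line_point[x xE]] := eqVneq v 0; first exact: mem0v.
  by have /LL' : pts L x; rewrite /pts /= xE -memvE.
pose good : set {vspace 'rV[K]_n.+1} := [set L | \dim L = 2%N /\
  forall v : 'rV[K]_n.+1, v \in L -> (f : {mpoly K[n.+1]}).@[v 0] = 0].
have -> : lines_in (hypersurface f) = [set pts L | L in good].
  apply/seteqP; split=> [l [[L dL ->] Lf]|_ [L [dL Lf] <-]] /=.
    exists L => //; split=> // v Lv.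
    have [w Lw w0] : exists2 w, w \in L & w != 0.
      have L0 : L != 0%VS by rewrite -dimv_eq0 dL.
      by exists (vpick L); rewrite ?memv_pick ?vpick0.
    have [v0|v0] := eqVneq v 0.
      have [x xE] := line_point w w0.
      by apply: (Lf x); rewrite /= xE -?memvE // v0 mem0v.
    have [x xE] := line_point v v0.
    by apply: (Lf x); rewrite /= xE -?memvE // memv_line.
  split; first by exists L.
  by move=> x /= /subvP xL v /xL/Lf.
apply: (inj_card_eq (A := good)) => L L' _ _ E; apply/eqP; rewrite eqEsubv.
by rewrite !pts_sub // E.
Qed.

(** * The tangent space of the parametrisation *)

Definition lin_form (R : comNzRingType) n (c : 'I_n -> R) : {mpoly R[n]} :=
  \sum_j c j *: 'X_j.

Lemma lin_formD (R : comNzRingType) n (c d : 'I_n -> R) :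
  lin_form (fun j => c j + d j) = lin_form c + lin_form d.
Proof. by rewrite -big_split; apply: eq_bigr => j _; rewrite scalerDl. Qed.

Lemma lin_formZ (R : comNzRingType) n a (c : 'I_n -> R) : lin_form (fun j => a * c j) = a *: lin_form c.
Proof. by rewrite scaler_sumr; apply: eq_bigr => j _; rewrite scalerA. Qed.

Lemma mpolyX_deg3 (R : comNzRingType) n (m : 'X_{1..n}) : mdeg m = 3%N ->
  exists i j k, 'X_[m] = 'X_i * 'X_j * 'X_k :> {mpoly R[n]}.
Proof.
have step (q : 'X_{1..n}) d : mdeg q = d.+1 ->
    exists i (q' : 'X_{1..n}), mdeg q' = d /\ 'X_[q] = 'X_i * 'X_[q'] :> {mpoly R[n]}.
  move=> dq; have [i qi] : exists i, (0 < q i)%N.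
    apply/existsP; apply: contra_eqT dq => /existsPn q0.
    by rewrite mdegE big1 // => i _; have := q0 i; case: (q i).
  have U : (U_(i) <= q)%MM by rewrite lep1mP -lt0n.
  exists i, (q - U_(i))%MM; rewrite -mpolyXD addmC submK //; split=> //.
  by apply/eqP; rewrite -(eqn_add2r 1) -(mdeg1 i) -mdegD submK // dq mdeg1 addn1.
move=> /step[i [m1 [/step[j [m2 [/step[k [m3 [/eqP + ->]]] ->]]] ->]]].
by rewrite mdeg_eq0 => /eqP->; exists i, j, k; rewrite mpolyX0 mulr1 mulrA.
Qed.

Section CubicIdeal.

Variable K : numFieldType.

Local Notation o k := (@Ordinal 4 k isT).
Local Notation x0 := ('X_(o 0) : {mpoly K[4]}).
Local Notation x1 := ('X_(o 1) : {mpoly K[4]}).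
Local Notation x2 := ('X_(o 2) : {mpoly K[4]}).
Local Notation z := ('X_(o 3) : {mpoly K[4]}).

(** The combinations of these quadrics with linear forms as coefficients are the
    tangent vectors of the parametrisation below, at the point where the four forms
    are 2 x0, 2 x1, 2 x2, z and their coefficients in the second relation are 1/2,
    1/2, 1/2, 1. *)
Definition tangent_quadric (i : 'I_5) : {mpoly K[4]} :=
  let s := x0 + x1 + x2 in
  nth 0 [:: 8 * x1 * x2 + 2 * s * z; 8 * x0 * x2 + 2 * s * z;
            8 * x0 * x1 + 2 * s * z; s ^+ 2 + 2 * s * z; z ^+ 2] i.

Local Notation q k := (tangent_quadric (@Ordinal 5 k isT)).
Local Notation s := (x0 + x1 + x2).

(** Five quadrics times four variables is 20, the dimension of the space of
    quaternary cubics.  Monomials are reached by decreasing power of [z], each step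
    working modulo the previous ones. *)
Lemma tangent_quadrics_generate (w : {mpoly K[4]}) : w \is 3.-homog ->
  exists al : 'I_5 -> 'I_4 -> K, w = \sum_i lin_form (al i) * tangent_quadric i.
Proof.
pose I w := exists al : 'I_5 -> 'I_4 -> K, w = \sum_i lin_form (al i) * tangent_quadric i.
rewrite -/(I w).
have I0 : I 0.
  exists (fun _ _ => 0); rewrite big1 // => i _; rewrite /lin_form big1 ?mul0r // => j _.
  by rewrite scale0r.
have ID u v : I u -> I v -> I (u + v).
  move=> [al ->] [be ->]; exists (fun i j => al i j + be i j).
  rewrite -big_split; apply: eq_bigr => i _; rewrite /= -mulrDl -big_split.
  by congr (_ * _); apply: eq_bigr => j _; rewrite scalerDl.
have IZ c u : I u -> I (c *: u).
  move=> [al ->]; exists (fun i j => c * al i j).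
  rewrite scaler_sumr; apply: eq_bigr => i _; rewrite scalerAl scaler_sumr.
  by congr (_ * _); apply: eq_bigr => j _; rewrite scalerA.
have IN u : I u -> I (- u) by move=> /(IZ (-1)); rewrite scaleN1r.
have IM n u : I u -> I (n%:R * u) by move=> /(IZ n%:R); rewrite -mul_mpolyC rmorph_nat.
have Idiv n u : I (n.+1%:R * u) -> I u.
  move=> /(IZ n.+1%:R^-1); rewrite -mul_mpolyC mulrA -(rmorph_nat (@mpolyC 4 K)) -rmorphM /=.
  by rewrite mulVf ?pnatr_eq0 // mul1r.
have IX i j : I ('X_j * tangent_quadric i).
  exists (fun i' j' => (i' == i)%:R * (j' == j)%:R).
  rewrite (bigD1 i) //= [X in _ + X]big1 => [|k /negPf ki].
    rewrite addr0 /lin_form (bigD1 j) //= !eqxx mulr1 scale1r big1 ?addr0 // => k /negPf->.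
    by rewrite mulr0 scale0r.
  by rewrite /lin_form big1 ?mul0r // => l _; rewrite ki mul0r scale0r.
have Ieq u v : u = v -> I u -> I v by move=> ->.
have comb (c : nat) u v : u = c.+1%:R * v -> I u -> I v by move=> ->; apply: Idiv.
have z2 j : I ('X_j * z ^+ 2) by exact: (IX (@Ordinal 5 4 isT) j).
have sz2 : I (s * z ^+ 2) by rewrite !mulrDl; apply/ID/z2/ID/z2/z2.
have z12 : I (z * x1 * x2).
  apply: (comb 7 (z * q 0 - 2 * (s * z ^+ 2))); first by rewrite /tangent_quadric /=; ring.
  by apply/ID/IN/IM.
have z02 : I (z * x0 * x2).
  apply: (comb 7 (z * q 1 - 2 * (s * z ^+ 2))); first by rewrite /tangent_quadric /=; ring.
  by apply/ID/IN/IM.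
have z01 : I (z * x0 * x1).
  apply: (comb 7 (z * q 2 - 2 * (s * z ^+ 2))); first by rewrite /tangent_quadric /=; ring.
  by apply/ID/IN/IM.
have zss : I (z * s ^+ 2).
  apply: (Ieq (z * q 3 - 2 * (s * z ^+ 2))); first by rewrite /tangent_quadric /=; ring.
  by apply/ID/IN/IM.
(* x0 x1 x2 cancels in x0 q0 - x1 q1 *)
have zs01 : I (z * s * (x0 - x1)).
  apply: (comb 1 (x0 * q 0 - x1 * q 1)); first by rewrite /tangent_quadric /=; ring.
  by apply/ID/IN.
have zs02 : I (z * s * (x0 - x2)).
  apply: (comb 1 (x0 * q 0 - x2 * q 2)); first by rewrite /tangent_quadric /=; ring.
  by apply/ID/IN.
have zs0 : I (z * s * x0).
  apply: (comb 2 (z * s ^+ 2 + z * s * (x0 - x1) + z * s * (x0 - x2))); first by ring.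
  by apply/ID/zs02/ID/zs01.
have zs1 : I (z * s * x1).
  by apply: (Ieq (z * s * x0 - z * s * (x0 - x1))); [ring|apply/ID/IN].
have zs2 : I (z * s * x2).
  by apply: (Ieq (z * s * x0 - z * s * (x0 - x2))); [ring|apply/ID/IN].
have z00 : I (z * x0 * x0).
  by apply: (Ieq (z * s * x0 - z * x0 * x1 - z * x0 * x2)); [ring|apply/ID/IN => //; exact/ID/IN].
have z11 : I (z * x1 * x1).
  by apply: (Ieq (z * s * x1 - z * x0 * x1 - z * x1 * x2)); [ring|apply/ID/IN => //; exact/ID/IN].
have z22 : I (z * x2 * x2).
  by apply: (Ieq (z * s * x2 - z * x0 * x2 - z * x1 * x2)); [ring|apply/ID/IN => //; exact/ID/IN].
(* from here on, multiples of z are known *)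
have x012 : I (x0 * x1 * x2).
  apply: (comb 7 (x0 * q 0 - 2 * (z * s * x0))); first by rewrite /tangent_quadric /=; ring.
  by apply/ID/IN/IM.
have x001 : I (x0 * x0 * x1).
  apply: (comb 7 (x0 * q 2 - 2 * (z * s * x0))); first by rewrite /tangent_quadric /=; ring.
  by apply/ID/IN/IM.
have x011 : I (x0 * x1 * x1).
  apply: (comb 7 (x1 * q 2 - 2 * (z * s * x1))); first by rewrite /tangent_quadric /=; ring.
  by apply/ID/IN/IM.
have x002 : I (x0 * x0 * x2).
  apply: (comb 7 (x0 * q 1 - 2 * (z * s * x0))); first by rewrite /tangent_quadric /=; ring.
  by apply/ID/IN/IM.
have x022 : I (x0 * x2 * x2).
  apply: (comb 7 (x2 * q 1 - 2 * (z * s * x2))); first by rewrite /tangent_quadric /=; ring.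
  by apply/ID/IN/IM.
have x112 : I (x1 * x1 * x2).
  apply: (comb 7 (x1 * q 0 - 2 * (z * s * x1))); first by rewrite /tangent_quadric /=; ring.
  by apply/ID/IN/IM.
have x122 : I (x1 * x2 * x2).
  apply: (comb 7 (x2 * q 0 - 2 * (z * s * x2))); first by rewrite /tangent_quadric /=; ring.
  by apply/ID/IN/IM.
have x000 : I (x0 * x0 * x0).
  apply: (Ieq (x0 * q 3 - 2 * (z * s * x0 + x0 * x0 * x1 + x0 * x0 * x2 + x0 * x1 * x2)
    - (x0 * x1 * x1 + x0 * x2 * x2))); first by rewrite /tangent_quadric /=; ring.
  by apply/ID/IN/ID/x022/x011/ID/IN/IM/ID/x012/ID/x002/ID/x001/zs0.
have x111 : I (x1 * x1 * x1).
  apply: (Ieq (x1 * q 3 - 2 * (z * s * x1 + x0 * x1 * x1 + x1 * x1 * x2 + x0 * x1 * x2)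
    - (x0 * x0 * x1 + x1 * x2 * x2))); first by rewrite /tangent_quadric /=; ring.
  by apply/ID/IN/ID/x122/x001/ID/IN/IM/ID/x012/ID/x112/ID/x011/zs1.
have x222 : I (x2 * x2 * x2).
  apply: (Ieq (x2 * q 3 - 2 * (z * s * x2 + x0 * x2 * x2 + x1 * x2 * x2 + x0 * x1 * x2)
    - (x0 * x0 * x2 + x1 * x1 * x2))); first by rewrite /tangent_quadric /=; ring.
  by apply/ID/IN/ID/x112/x002/ID/IN/IM/ID/x012/ID/x122/ID/x022/zs2.
pose T (i j k : 'I_4) := I ('X_i * 'X_j * 'X_k).
have T01 i j k : T i j k -> T j i k by rewrite /T (mulrC 'X_i).
have T12 i j k : T i j k -> T i k j by rewrite /T -!mulrA (mulrC 'X_j).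
have Tsorted (i j k : 'I_4) : (i <= j <= k)%N -> T i j k.
  have ordE (l : 'I_4) : l = o 0 \/ l = o 1 \/ l = o 2 \/ l = o 3.
    case: l => [[|[|[|[|//]]]] l4]; [left|right; left|do 2!right; left|do 3!right]; exact: val_inj.
  have zl u : I (z * u) -> I (u * z) by rewrite mulrC.
  have z22' u : I (u * z ^+ 2) -> I (u * z * z) by rewrite -mulrA -expr2.
  case: (ordE i) => [->|[->|[->|->]]]; case: (ordE j) => [->|[->|[->|->]]] //;
    case: (ordE k) => [->|[->|[->|->]]] // _; rewrite /T //;
    try exact/z22'; try exact: x000; apply: zl; rewrite mulrA //.
have Tall (i j k : 'I_4) : T i j k.
  have [ij|/ltnW ji] := leqP i j; have [jk|/ltnW kj] := leqP j k;
    have [ik|/ltnW ki] := leqP i k.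
  - by apply: Tsorted; rewrite ij.
  - by apply: Tsorted; rewrite ij.
  - by apply/T12/Tsorted; rewrite ik.
  - by apply/T12/T01/Tsorted; rewrite ki.
  - by apply/T01/Tsorted; rewrite ji.
  - by apply/T01/T12/Tsorted; rewrite jk.
  - by apply/T01/T12/T01/Tsorted; rewrite kj.
  - by apply/T01/T12/T01/Tsorted; rewrite kj.
move=> /dhomogP hw; rewrite [w]mpolyE big_seq; apply: (big_ind I) => // m /hw md.
by apply: IZ; have [i [j [k ->]]] := mpolyX_deg3 K md; exact: Tall.
Qed.

End CubicIdeal.

(** * Parametrisation of cubics *)

Section TrihedralForm.

Local Notation o k := (@Ordinal 4 k isT).

Lemma big_ord4 (V : zmodType) (F : 'I_4 -> V) :
  \sum_i F i = F (o 0) + F (o 1) + F (o 2) + F (o 3).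
Proof.
rewrite !big_ord_recl big_ord0 addr0 !addrA.
by congr (F _ + F _ + F _ + F _); apply: val_inj.
Qed.

Lemma big_ord5 (V : zmodType) (F : 'I_5 -> V) (o5 := fun k (lt_k : (k < 5)%N) => Ordinal lt_k) :
  \sum_i F i = F (o5 0 isT) + F (o5 1 isT) + F (o5 2 isT) + F (o5 3 isT) + F (o5 4 isT).
Proof.
rewrite !big_ord_recl big_ord0 addr0 !addrA.
by congr (F _ + F _ + F _ + F _ + F _); apply: val_inj.
Qed.

(** Six vectors built from four, subject to the two relations of coefficients
    (1, ..., 1) and [trihedral_coef b]: the last two vectors solve them.  The module
    is arbitrary so that the same formula serves for polynomials, for linear forms
    and for their values. *)
Definition trihedral_form (R : nzRingType) (L : lmodType R) (b : 'I_4 -> R)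
    (l : 'I_4 -> L) (k : 'I_3 + 'I_3) : L :=
  let m := \sum_i b i *: l i in
  match k with
  | inl i => nth 0 [:: l (o 0); l (o 1); l (o 2)] i
  | inr j => nth 0 [:: l (o 3); - m; m - \sum_i l i] j
  end.

Definition trihedral_coef (R : nzRingType) (b : 'I_4 -> R) (k : 'I_3 + 'I_3) : R :=
  match k with
  | inl i => nth 0 [:: b (o 0); b (o 1); b (o 2)] i
  | inr j => nth 0 [:: b (o 3); 1; 0] j
  end.

Lemma sum_trihedral_form (R : nzRingType) (L : lmodType R) b (l : 'I_4 -> L) :
  \sum_k trihedral_form b l k = 0.
Proof.
rewrite big_sumType !big_ord_recl !big_ord0 /= (big_ord4 l) !addr0 addKr addrA.
by rewrite addrA subrr.
Qed.

Lemma sum_trihedral_coef (R : nzRingType) (L : lmodType R) b (l : 'I_4 -> L) :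
  \sum_k trihedral_coef b k *: trihedral_form b l k = 0.
Proof.
rewrite big_sumType !big_ord_recl !big_ord0 /= big_ord4 scale1r scale0r !addr0.
by rewrite !addrA subrr.
Qed.

Lemma linear_trihedral_form (R : nzRingType) (L L' : lmodType R) (f : L -> L') b l k :
  linear f -> f (trihedral_form b l k) = trihedral_form b (f \o l) k.
Proof.
move=> fl; pose g : {linear L -> L'} := HB.pack f (GRing.isLinear.Build _ _ _ _ f fl).
have fN u : f (- u) = - f u by exact: (linearN g).
have fD u v : f (u + v) = f u + f v by exact: (linearD g).
have fm : f (\sum_i b i *: l i) = \sum_i b i *: f (l i).
  by rewrite [LHS](linear_sum g); apply: eq_bigr => i _; rewrite linearZ.
have fs : f (\sum_i l i) = \sum_i f (l i) by exact: (linear_sum g).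
by rewrite /trihedral_form; case: k => -[[|[|[|//]]] lt_k] //=; rewrite ?fD !fN ?fm ?fs.
Qed.

End TrihedralForm.

Section Parametrization.

Variable K : numClosedFieldType.

Local Notation o k := (@Ordinal 4 k isT).
(* the 16 coefficients of four linear forms, followed by the 4 scalars of trihedral_coef *)
Local Notation param := ('I_(4 * 4 + 4) -> K).

Definition mx_of (x : param) : 'M[K]_4 :=
  \matrix_(i, j) x (lshift 4 (mxvec_index i j)).

Definition coef_of (x : param) (k : 'I_4) : K := x (rshift (4 * 4) k).

Definition param_of (M : 'M[K]_4) (b : 'I_4 -> K) : param :=
  row_mx (mxvec M) (\row_k b k) 0.

Lemma mx_of_param M b : mx_of (param_of M b) = M.
Proof. by apply/matrixP => i j; rewrite mxE /param_of row_mxEl mxvecE. Qed.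

Lemma coef_of_param M b : coef_of (param_of M b) =1 b.
Proof. by move=> k; rewrite /coef_of /param_of row_mxEr mxE. Qed.

Definition forms_of (x : param) (k : 'I_4) : {mpoly K[4]} :=
  lin_form (fun j => mx_of x j k).

Definition cubic_of (x : param) : {mpoly K[4]} :=
  let y := trihedral_form (coef_of x) (forms_of x) in
  \prod_i y (inl i) + \prod_j y (inr j).

(** The homogeneous part of degree 3, as a linear map onto the space of cubics: it
    transports linear identities between polynomials to that space. *)
Definition cubic_part (w : {mpoly K[4]}) : hpoly K 3 3 := DHomog (pihomogP mdeg 3 w).

Lemma cubic_part_is_linear : linear cubic_part.
Proof. by move=> a u v; apply: val_inj; rewrite /= linearP. Qed.

HB.instance Definition _ := GRing.isLinear.Build K {mpoly K[4]} (hpoly K 3 3) _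
  cubic_part cubic_part_is_linear.

Lemma cubic_of_homog x : cubic_of x \is 3.-homog.
Proof.
have lin k : forms_of x k \is 1.-homog.
  by apply: rpred_sum => j _; apply: rpredZ; rewrite dhomogX /= mdeg1.
have tri k : trihedral_form (coef_of x) (forms_of x) k \is 1.-homog.
  have ms : \sum_i coef_of x i *: forms_of x i \is 1.-homog.
    by apply: rpred_sum => j _; apply: rpredZ.
  case: k => -[[|[|[|//]]] lt_k] //=; first by rewrite rpredN.
  by rewrite rpredB // rpred_sum.
have pr (u : 'I_3 -> {mpoly K[4]}) : (forall i, u i \is 1.-homog) -> \prod_i u i \is 3.-homog.
  by move=> hu; rewrite !big_ord_recl big_ord0 mulr1; apply/(@dhomogM _ _ _ 1)/(@dhomogM _ _ _ 1).
by apply: rpredD; apply: pr.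
Qed.

Lemma poly_map_cubic_of : poly_map cubic_of.
Proof.
have pl k : poly_map (fun x => forms_of x k).
  apply: poly_map_sum => j; have [s sE] := poly_mapZ 'X_(lshift 4 (mxvec_index j k)) (@poly_map_cst K (4 * 4 + 4) _ ('X_j : {mpoly K[4]})).
  by exists s => x; rewrite -sE mevalXU mxE.
have pm : poly_map (fun x => \sum_i coef_of x i *: forms_of x i).
  apply: poly_map_sum => i; have [s sE] := poly_mapZ 'X_(rshift (4 * 4) i) (pl i).
  by exists s => x; rewrite -sE mevalXU.
have tri k : poly_map (fun x => trihedral_form (coef_of x) (forms_of x) k).
  case: k => -[[|[|[|//]]] lt_k] /=; try exact: pl.
    exact: poly_mapN.
  by apply: poly_mapD => //; apply: poly_mapN; apply: poly_map_sum.
by apply: poly_mapD; apply: poly_map_prod.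
Qed.

Lemma cubic_ofE x : cubic_of x =
  let l := forms_of x in let m := \sum_i coef_of x i *: l i in
  l (o 0) * l (o 1) * l (o 2) + l (o 3) * - m * (m - \sum_i l i).
Proof.
rewrite /=; set m := \sum_i _ *: _; set sl := \sum_i _.
by rewrite /cubic_of !big_ord_recl !big_ord0 /= !mulr1 !mulrA.
Qed.

(** The cubic along a line in the space of forms and scalars.  The coefficients of
    [a0], ..., [a3], [g] in the term linear in [t] are the five [tangent_quadric]s;
    the velocity of the scalars enters through [S - g]. *)
Lemma curve_expansion (A : comNzRingType) (x0 x1 x2 z a0 a1 a2 a3 g m2 : A) :
  let s := x0 + x1 + x2 in let S := a0 + a1 + a2 in
  exists P2 P3 P4 P5, forall t,
  let m := s + z + t * (2 * S - g + a3) + t ^+ 2 * m2 in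
  (2 * x0 + t * (2 * a0)) * (2 * x1 + t * (2 * a1)) * (2 * x2 + t * (2 * a2))
   + (z + t * a3) * - m * (m - (2 * s + z + t * (2 * S + a3))) =
  (2 * x0 * (2 * x1) * (2 * x2) + z * (s + z) * s) +
  t * (a0 * (8 * x1 * x2 + 2 * s * z) + a1 * (8 * x0 * x2 + 2 * s * z)
     + a2 * (8 * x0 * x1 + 2 * s * z) + a3 * (s ^+ 2 + 2 * s * z) + g * z ^+ 2) +
  (t ^+ 2 * P2 + (t ^+ 3 * P3 + (t ^+ 4 * P4 + t ^+ 5 * P5))).
Proof.
move=> s S; pose m1 := 2 * S - g + a3.
pose c2 := (s + z) * m2 + m1 * - g + m2 * - s; pose c3 := m1 * m2 + m2 * - g.
exists (8 * (x0 * a1 * a2 + a0 * x1 * a2 + a0 * a1 * x2)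
        - (z * c2 + a3 * ((s + z) * - g + m1 * - s))),
       (8 * a0 * a1 * a2 - (z * c3 + a3 * c2)),
       (- (z * m2 ^+ 2 + a3 * c3)), (- (a3 * m2 ^+ 2)) => t /=.
by rewrite /c2 /c3 /m1 /S /s; ring.
Qed.

(** The velocity is chosen so that the linear term of [curve_expansion] is the
    decomposition of [w] along the tangent quadrics. *)
Lemma curves_in_every_direction : exists p0 : {mpoly K[4]},
  forall w : {mpoly K[4]}, w \is 3.-homog ->
  exists (c : K -> param) (s : seq {mpoly K[4]}),
    forall t, cubic_of (c t) = p0 + t *: w + \sum_(i < size s) t ^+ i.+2 *: s`_i.
Proof.
pose dg (k : 'I_4) : K := if k == o 3 then 1 else 2.
pose b0 (k : 'I_4) : K := if k == o 3 then 1 else 2^-1.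
pose z : {mpoly K[4]} := 'X_(o 3).
pose s : {mpoly K[4]} := 'X_(o 0) + 'X_(o 1) + 'X_(o 2).
exists (2 * 'X_(o 0) * (2 * 'X_(o 1)) * (2 * 'X_(o 2)) + z * (s + z) * s) => w w3.
have [al wE] := tangent_quadrics_generate w3.
pose A i := lin_form (al i).
pose i5 k lt_k := @Ordinal 5 k lt_k.
pose ga j := al (i5 0 isT) j + al (i5 1 isT) j + al (i5 2 isT) j - al (i5 4 isT) j.
pose N : 'M[K]_4 := \matrix_(j, k) (dg k * al (widen_ord (leqnSn 4) k) j).
pose c t := param_of (\matrix_(j, k) ((j == k)%:R * dg k) + t *: N) (fun k => b0 k + t * ((dg k)^-1 * ga k)).
pose L (k : 'I_4) : {mpoly K[4]} := dg k *: 'X_k.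
pose B (k : 'I_4) : {mpoly K[4]} := dg k *: A (widen_ord (leqnSn 4) k).
have formsE t k : forms_of (c t) k = L k + t *: B k.
  rewrite /forms_of mx_of_param.
  transitivity (lin_form (fun j => (j == k)%:R * dg k + t * (dg k * al (widen_ord (leqnSn 4) k) j))).
    by apply: eq_bigr => j _; rewrite !mxE.
  rewrite lin_formD lin_formZ lin_formZ; congr (_ + _).
  rewrite /lin_form (bigD1 k) //= eqxx mul1r big1 ?addr0 // => j /negPf->.
  by rewrite mul0r scale0r.
have dg0 k : dg k != 0 by rewrite /dg; case: ifP => _; rewrite ?oner_neq0 ?pnatr_eq0.
pose m2 := \sum_k ((dg k)^-1 * ga k) *: B k.
pose S := A (i5 0 isT) + A (i5 1 isT) + A (i5 2 isT).
pose A3 := A (i5 3 isT); pose G := A (i5 4 isT).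
have coefE t : \sum_i coef_of (c t) i *: forms_of (c t) i =
   (s + z) + t *: (2 * S - G + A3) + t ^+ 2 *: m2.
  have -> : \sum_i coef_of (c t) i *: forms_of (c t) i =
     \sum_i b0 i *: L i + t *: (\sum_i ((dg i)^-1 * ga i) *: L i + \sum_i b0 i *: B i) + t ^+ 2 *: m2.
    rewrite scalerDr !scaler_sumr -!big_split; apply: eq_bigr => i _ /=.
    rewrite coef_of_param formsE scalerDr !scalerDl !scalerA !addrA.
    rewrite -!mul_mpolyC !rmorphM /= -!addrA; congr (_ + _).
    by ring.
  congr (_ + _ *: _ + _).
  - rewrite big_ord4 /L /b0 /dg /= !scalerA mulr1 scale1r.
    by rewrite mulVf ?scale1r // pnatr_eq0.
  - transitivity ((S - G) + (S + A3)); last by ring.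
    congr (_ + _).
      rewrite /S /G /A /lin_form -sumrN -!big_split; apply: eq_bigr => i _ /=.
      by rewrite /L scalerA mulrAC mulVf // mul1r /ga !scalerDl scaleNr.
    have b0dg i : b0 i * dg i = 1.
      by rewrite /b0 /dg; case: ifP => _; rewrite ?mulr1 // mulVf // pnatr_eq0.
    under eq_bigr do rewrite /B scalerA b0dg scale1r.
    by rewrite big_ord4; congr (A _ + A _ + A _ + A _); apply: val_inj.
have sumE t : \sum_i forms_of (c t) i = (2 * s + z) + t *: (2 * S + A3).
  under eq_bigr do rewrite formsE.
  rewrite big_split -scaler_sumr /=; congr (_ + _ *: _); rewrite big_ord4 /L /B /dg /= !scale1r.
    by rewrite !scaler_nat /s /z; ring.
  rewrite !scaler_nat /S /A3 (_ : A _ = A (i5 0 isT)); last by congr A; apply: val_inj.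
  rewrite (_ : A (widen_ord _ (o 1)) = A (i5 1 isT)); last by congr A; apply: val_inj.
  rewrite (_ : A (widen_ord _ (o 2)) = A (i5 2 isT)); last by congr A; apply: val_inj.
  rewrite (_ : A (widen_ord _ (o 3)) = A (i5 3 isT)); last by congr A; apply: val_inj.
  by ring.
have wE' : w = A (i5 0 isT) * (8 * 'X_(o 1) * 'X_(o 2) + 2 * s * z)
   + A (i5 1 isT) * (8 * 'X_(o 0) * 'X_(o 2) + 2 * s * z)
   + A (i5 2 isT) * (8 * 'X_(o 0) * 'X_(o 1) + 2 * s * z)
   + A3 * (s ^+ 2 + 2 * s * z) + G * z ^+ 2.
  by rewrite wE big_ord5.
have [P2 [P3 [P4 [P5 PE]]]] := curve_expansion 'X_(o 0) 'X_(o 1) 'X_(o 2) z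
  (A (i5 0 isT)) (A (i5 1 isT)) (A (i5 2 isT)) A3 G m2.
exists c, [:: P2; P3; P4; P5] => t.
have LE k : L k = (if k == o 3 then 1 else 2) * 'X_k.
  by rewrite /L /dg; case: ifP => _; rewrite ?scale1r ?mul1r // scaler_nat mulr_natl.
have BE (k : 'I_4) (i : 'I_5) : k = i :> nat -> B k = (if k == o 3 then 1 else 2) * A i.
  move=> ki; rewrite /B (_ : widen_ord _ k = i); last exact: val_inj.
  by rewrite /dg; case: ifP => _; rewrite ?scale1r ?mul1r // scaler_nat mulr_natl.
have tX (a : K) k (u : {mpoly K[4]}) : a ^+ k *: u = a%:MP_[4] ^+ k * u.
  by rewrite -mul_mpolyC; congr (_ * _); rewrite rmorphXn.
rewrite cubic_ofE /= coefE sumE !formsE !LE (BE _ (i5 0 isT)) // (BE _ (i5 1 isT)) //.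
rewrite (BE _ (i5 2 isT)) // (BE _ (i5 3 isT)) // !mul1r !big_ord_recl big_ord0 /= addr0.
by rewrite !tX -!mul_mpolyC PE -wE'.
Qed.

End Parametrization.

(** * Good parameters *)

Section GoodParameters.

Local Notation o k := (@Ordinal 4 k isT).

(** The binary cubic of [balanced (trihedral_coef b)] is [t] times the quadratic form
    [root_coef1 b * s ^+ 2 + root_coef2 b * s * t + root_coef3 b * t ^+ 2]: the root
    [t = 0] is the relation (1, ..., 1). *)
Definition root_coef1 (R : nzRingType) (b : 'I_4 -> R) :=
  b (o 0) + b (o 1) + b (o 2) - b (o 3) - 1.
Definition root_coef2 (R : nzRingType) (b : 'I_4 -> R) :=
  b (o 0) * b (o 1) + b (o 0) * b (o 2) + b (o 1) * b (o 2) - b (o 3).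
Definition root_coef3 (R : nzRingType) (b : 'I_4 -> R) := b (o 0) * b (o 1) * b (o 2).
Definition root_discr (R : nzRingType) (b : 'I_4 -> R) :=
  root_coef2 b ^+ 2 - 4 * root_coef1 b * root_coef3 b.

Lemma balancedE (K : numFieldType) (b : 'I_4 -> K) (r : K * K) :
  balanced (trihedral_coef b) r <->
  r.2 * (root_coef1 b * r.1 ^+ 2 + root_coef2 b * r.1 * r.2 + root_coef3 b * r.2 ^+ 2) = 0.
Proof.
rewrite /balanced; set l := \prod_i _; set m := \prod_i _; set p := _ * _.
have <- : l - m = p.
  rewrite /l /m /p !big_ord_recl !big_ord0 /rel_coef /= /root_coef1 /root_coef2 /root_coef3.
  by ring.
by split=> [->|/eqP]; rewrite ?subrr // subr_eq0 => /eqP.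
Qed.

Lemma root_quadratic (K : numClosedFieldType) (b : 'I_4 -> K) :
  root_coef1 b != 0 -> root_discr b != 0 -> exists x1 x2, x1 != x2 /\
    forall s t, root_coef1 b * s ^+ 2 + root_coef2 b * s * t + root_coef3 b * t ^+ 2 =
      root_coef1 b * (s - x1 * t) * (s - x2 * t).
Proof.
rewrite /root_discr; move: (root_coef1 b) (root_coef2 b) (root_coef3 b) => q1 q2 q3 q10 d0.
set D := (q2 ^+ 2 - _) in d0; pose d := sqrtC D.
have dd : d ^+ 2 = D by exact: sqrtCK.
have nz2 : 2 != 0 :> K by rewrite pnatr_eq0.
exists ((- q2 + d) / (2 * q1)), ((- q2 - d) / (2 * q1)); split.
  rewrite -subr_eq0 -mulrBl mulf_neq0 ?invr_eq0 ?mulf_neq0 //.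
  have -> : - q2 + d - (- q2 - d) = 2 * d by ring.
  by rewrite mulf_neq0 // sqrtC_eq0.
move=> s t; have -> : q3 = (q2 ^+ 2 - d ^+ 2) / (4 * q1).
  by rewrite dd /D; field; rewrite q10.
by field; rewrite q10.
Qed.

Variable K : numClosedFieldType.

Definition row_form (c : 'I_4 -> K) (v : 'rV[K]_4) : K^o := \sum_j c j * v 0 j.

Lemma row_form_is_linear c : linear (row_form c).
Proof.
move=> a u v; rewrite /row_form scaler_sumr -big_split; apply: eq_bigr => j _ /=.
by rewrite !mxE mulrDr mulrCA.
Qed.

HB.instance Definition _ c := GRing.isLinear.Build K 'rV[K]_4 K^o _ (row_form c)
  (row_form_is_linear c).

Lemma card_lines_cubic_of (x : 'I_(4 * 4 + 4) -> K) (b := coef_of x) :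
  mx_of x \in unitmx -> injective (trihedral_coef b) ->
  root_coef1 b != 0 -> root_discr b != 0 ->
  (lines_in (hypersurface (DHomog (cubic_of_homog x) : hpoly K 3 3)) #= `I_27)%card.
Proof.
move=> Mu a_inj q0 d0; set M := mx_of x in Mu; pose a := trihedral_coef b.
pose y := trihedral_form b (fun k => linfun (row_form (fun j => M j k))).
pose z4 (v : 'rV[K]_4) k : K^o := row_form (fun j => M j k) v.
have yE k v : y k v = trihedral_form b (z4 v) k.
  have fl : linear (fun h : 'Hom('rV[K]_4, K^o) => h v).
    by move=> c g h; rewrite add_lfunE scale_lfunE.
  apply: etrans (linear_trihedral_form b _ k fl) _.
  by apply: (congr1 (fun u => trihedral_form b u k)); apply: funext => i; rewrite /= lfunE.
have fE k (v : 'rV[K]_4) : (trihedral_form b (forms_of x) k).@[v 0] = y k v.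
  have fl : linear (fun p : {mpoly K[4]} => p.@[v 0] : K^o).
    by move=> c g h; rewrite mevalD mevalZ.
  rewrite yE; apply: etrans (linear_trihedral_form b _ k fl) _.
  apply: (congr1 (fun u => trihedral_form b u k)); apply: funext => i; rewrite /= /forms_of /lin_form raddf_sum; apply: eq_bigr => j _.
  by rewrite /= mevalZ mevalXU.
have fv (v : 'rV[K]_4) : (cubic_of x).@[v 0] =
    \prod_i (y (inl i) v : K) + \prod_j (y (inr j) v : K).
  by rewrite /cubic_of mevalD !rmorph_prod; congr (_ + _); apply: eq_bigr => i _; exact: fE.
have z4E v k : z4 v k = (v *m M) 0 k.
  by rewrite mxE; apply: eq_bigr => j _; rewrite mulrC.
have [x1 [x2 [x12 qE]]] := root_quadratic q0 d0.
(* the root t = 0 and the two roots of the quadratic form *)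
pose rho (i : 'I_3) : K * K := nth 0 [:: (1, 0); (x1, 1); (x2, 1)] i.
apply: card_eq_trans (card_lines_in _) _.
have -> : [set L : {vspace 'rV[K]_4} | \dim L = 2%N /\ forall v, v \in L ->
    ((DHomog (cubic_of_homog x) : hpoly K 3 3) : {mpoly K[4]}).@[v 0] = 0] =
    [set L | \dim L = 2%N /\ cubic_vanishes y L].
  by apply/seteqP; split=> L [dL H]; split=> // v Lv; rewrite /= ?fv //; [rewrite -fv|]; exact: H.
apply: (@lines_of_trihedral_cubic K _ y a _ _ _ _ _ _ rho) => //.
- by rewrite dimvf /= /dim /= mul1n.
- move=> v; under eq_bigr do rewrite yE.
  exact: (@sum_trihedral_form K K^o).
- move=> v; under eq_bigr do rewrite yE.
  exact: (@sum_trihedral_coef K K^o).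
- move=> z; rewrite !big_sumType !big_ord_recl !big_ord0 /= mul1r mul0r !addr0 => S0 S1.
  have R1 : z (inr (lift ord0 ord0)) = - (b (o 0) * z (inl ord0) + b (o 1) * z (inl (lift ord0 ord0))
      + b (o 2) * z (inl (lift ord0 (lift ord0 ord0))) + b (o 3) * z (inr ord0)).
    by apply/eqP; rewrite -addr_eq0; apply/eqP; rewrite -[RHS]S1; ring.
  have R2 : z (inr (lift ord0 (lift ord0 ord0))) = - z (inr (lift ord0 ord0)) - (z (inl ord0)
      + z (inl (lift ord0 ord0)) + z (inl (lift ord0 (lift ord0 ord0))) + z (inr ord0)).
    by apply/eqP; rewrite -subr_eq0; apply/eqP; rewrite -[RHS]S0; ring.
  rewrite R1 opprK in R2.
  pose zr : 'rV[K]_4 := \row_k nth 0 [:: z (inl ord0); z (inl (lift ord0 ord0)); z (inl (lift ord0 (lift ord0 ord0))); z (inr ord0)] k.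
  exists (zr *m invmx M) => k; rewrite yE.
  have E i : z4 (zr *m invmx M) i = zr 0 i by rewrite z4E mulmxKV.
  case: k => i; elim/ord3_ind: i; rewrite /= ?E ?big_ord4 ?E !mxE //=.
- move=> v yv; have vM : v *m M = 0.
    apply/rowP => k; rewrite -z4E mxE.
    have Y k' : trihedral_form b (z4 v) k' = 0 by rewrite -yE yv.
    case: k => [[|[|[|[|//]]]] lt_k].
    - by rewrite -[RHS](Y (inl ord0)); congr (z4 v _); apply: val_inj.
    - by rewrite -[RHS](Y (inl (lift ord0 ord0))); congr (z4 v _); apply: val_inj.
    - by rewrite -[RHS](Y (inl (lift ord0 (lift ord0 ord0)))); congr (z4 v _); apply: val_inj.
    - by rewrite -[RHS](Y (inr ord0)); congr (z4 v _); apply: val_inj.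
  by rewrite -(mulmxK Mu v) vM mul0mx.
- by elim/ord3_ind; rewrite /rho /= xpair_eqE oner_eq0 ?andbF.
- elim/ord3_ind; apply/balancedE; rewrite /rho /= ?mul0r // qE.
    by rewrite !mulr1 subrr mulr0 mul0r mulr0.
  by rewrite !mulr1 subrr !mulr0.
- elim/ord3_ind; elim/ord3_ind; rewrite /rho //= ?mulr1 ?mul1r ?mulr0 ?mul0r.
  + by move/eqP; rewrite oner_eq0.
  + by move/eqP; rewrite oner_eq0.
  + by move/esym/eqP; rewrite oner_eq0.
  + by move/eqP; rewrite (negPf x12).
  + by move/esym/eqP; rewrite oner_eq0.
  + by move/esym/eqP; rewrite (negPf x12).
move=> [s t] st0 /balancedE /=; rewrite qE => /eqP; rewrite !mulf_eq0 (negPf q0) /=.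
case/orP=> [/eqP t0|/orP[]]; rewrite ?subr_eq0.
- by exists ord0, s; rewrite /rho /= mulr1 mulr0 t0.
- by move/eqP->; exists (lift ord0 ord0), t; rewrite /rho /= mulr1 mulrC.
- by move/eqP->; exists (lift ord0 (lift ord0 ord0)), t; rewrite /rho /= mulr1 mulrC.
Qed.

End GoodParameters.

(** * Twenty-seven lines *)

(** Nonzero exactly when the six forms are in general position and the binary cubic
    has three distinct roots. *)
Definition genericity (R : comNzRingType) (M : 'M[R]_4) (b : 'I_4 -> R) : R :=
  \det M * (\prod_(k : 'I_3 + 'I_3) \prod_(l : 'I_3 + 'I_3 | l != k)
              (trihedral_coef b k - trihedral_coef b l)) *
  (root_coef1 b * root_discr b).

Lemma rmorph_genericity (R S : comNzRingType) (f : {rmorphism R -> S}) M b :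
  f (genericity M b) = genericity (map_mx f M) (f \o b).
Proof.
have fc k : f (trihedral_coef b k) = trihedral_coef (f \o b) k.
  by case: k => -[[|[|[|//]]] lt_k] //=; rewrite ?rmorph0 ?rmorph1.
rewrite /genericity !rmorphM rmorph_prod det_map_mx; congr (_ * _ * (_ * _)).
- by apply: eq_bigr => k _; rewrite rmorph_prod; apply: eq_bigr => l _; rewrite rmorphB !fc.
- by rewrite /root_coef1 !rmorphB !rmorphD /= rmorph1.
rewrite /root_discr /root_coef1 /root_coef2 /root_coef3.
by rewrite !(rmorphB, rmorphM, rmorphD, rmorph1, rmorphXn, rmorph_nat).
Qed.

(** Here [trihedral_coef] takes the values 2, 3, 5 and 4, 1, 0, for which the
    quadratic form is 5 s^2 + 27 s t + 30 t^2. *)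
Lemma genericity_neq0 (K : numFieldType) :
  genericity (1%:M : 'M[K]_4) (fun k => (nth 0 [:: 2; 3; 5; 4] k)%:R) != 0.
Proof.
set b := fun _ => _.
pose N (k : 'I_3 + 'I_3) : nat := match k with
  | inl i => nth 0 [:: 2; 3; 5] i | inr j => nth 0 [:: 4; 1; 0] j end.
have bN k : trihedral_coef b k = (N k)%:R by case: k => -[[|[|[|//]]] lt_k].
have N_inj : injective N.
  by move=> [] [[|[|[|//]]] ?] [] [[|[|[|//]]] ?] //= _; congr (_ _); apply: val_inj.
rewrite /genericity det1 mul1r !mulf_neq0 //.
- apply/prodf_neq0 => k _; apply/prodf_neq0 => l lk.
  by rewrite !bN subr_eq0 eqr_nat (inj_eq N_inj) eq_sym.
- have -> : root_coef1 b = 5 by rewrite /root_coef1 /b /=; ring.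
  by rewrite pnatr_eq0.
have -> : root_discr b = 129 by rewrite /root_discr /root_coef1 /root_coef2 /root_coef3 /b /=; ring.
by rewrite pnatr_eq0.
Qed.

Lemma genericity_good (K : numClosedFieldType) (M : 'M[K]_4) b : genericity M b != 0 ->
  [/\ M \in unitmx, injective (trihedral_coef b), root_coef1 b != 0 & root_discr b != 0].
Proof.
rewrite /genericity !mulf_eq0 !negb_or => /andP[/andP[dM da] /andP[-> ->]]; split=> //.
  by rewrite unitmxE unitfE.
move=> k l kl; apply/eqP/negPn/negP => ne; move: da => /prodf_neq0/(_ k isT).
by move=> /prodf_neq0/(_ l); rewrite eq_sym ne kl subrr eqxx => /(_ isT).
Qed.

Theorem generic_cubic_27_lines (K : numClosedFieldType) :
  generic (fun f : hpoly K 3 3 => (lines_in (hypersurface f) #= `I_27)%card).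
Proof.
pose Mp : 'M[{mpoly K[4 * 4 + 4]}]_4 := \matrix_(i, j) 'X_(lshift 4 (mxvec_index i j)).
pose bp (k : 'I_4) : {mpoly K[4 * 4 + 4]} := 'X_(rshift (4 * 4) k).
have gE x : (genericity Mp bp).@[x] = genericity (mx_of x) (coef_of x).
  rewrite rmorph_genericity; congr genericity.
    by apply/matrixP => i j; rewrite !mxE /= mevalXU.
  by apply: funext => k; rewrite /= mevalXU.
apply: (@generic_of_dominant K (hpoly K 3 3) (4 * 4 + 4) (genericity Mp bp)
  (fun x => DHomog (cubic_of_homog x))).
- apply: contraNneq (genericity_neq0 K) => g0.
  rewrite -[genericity _ _](_ : (genericity Mp bp).@[param_of 1%:M (fun k => (nth 0%N [:: 2; 3; 5; 4]%N k)%:R)] = _).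
    by rewrite g0 meval0.
  by rewrite gE mx_of_param; congr genericity; apply: funext => k; rewrite coef_of_param.
- have [s sE] := poly_map_linear (@cubic_part K) (@poly_map_cubic_of K).
  exists s => x; rewrite -sE; apply: val_inj.
  by rewrite /= pihomog_dE // cubic_of_homog.
- have [p0 H] := curves_in_every_direction K.
  exists (cubic_part p0) => w.
  have [c [s cE]] := H w (dhomog_is_dhomog w).
  exists c, [seq cubic_part u | u <- s] => t.
  have -> : DHomog (cubic_of_homog (c t)) = cubic_part (cubic_of (c t)).
    by apply: val_inj; rewrite /= pihomog_dE // cubic_of_homog.
  rewrite cE !linearD linearZ /= linear_sum size_map; congr (_ + _ *: _ + _).
    by apply: val_inj; rewrite /= pihomog_dE //; exact: dhomog_is_dhomog.
  by apply: eq_bigr => i _; rewrite linearZ (nth_map 0).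
move=> x; rewrite gE => /genericity_good[Mu a_inj q0 d0].
exact: card_lines_cubic_of.
Qed.

Local Open Scope card_scope.
Local Open Scope complex_scope.

Theorem corollary7 (R : realType) :
  generic (fun f : hpoly R[i] 3 3 => lines_in (hypersurface f) #= `I_27).
Proof. exact: generic_cubic_27_lines. Qed.
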